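(* Let $V=\{\nu_1,\dots,\nu_r\}$, $r>1$, be a finite set of divisorial valuations of $R$, let $C$ be a general curve of $V$, and let $V^{(k)}$ ($k\ge0$) be the finite sets of divisorial valuations approaching $C$ defined in the context. Then $$\lim_{k\to\infty}P_{V^{(k)}}(t_1,\dots,t_r)=P_C(t_1,\dots,t_r).$$
   Context: $(R,\mathfrak m)$ is a complete regular local ring of dimension $2$ with an algebraically closed coefficient field $K$. A modification $\pi:X\to\operatorname{Spec}R$ is a nonempty finite composition of point blow-ups, the first one with center $\mathfrak m$ and each following one with center a closed point of the exceptional divisor already created; $E$ is its total exceptional divisor, with irreducible components $E_\alpha$. The $E_\alpha$-valuation sends $f\in R$ to the vanishing order of $f\circ\pi$ along $E_\alpha$. A divisorial valuation is a discrete valuation of the fraction field of $R$, centered at $R$, of rank $1$ and transcendence degree $1$; equivalently, the $E_\alpha$-valuation of some component of some modification. The minimal resolution $\pi:(X,E)\to\operatorname{Spec}R$ of $V$ is the minimal modification such that each $\nu_i$ is the $E_{\alpha(i)}$-valuation for some component $E_{\alpha(i)}$ of $E$. $Q_{\alpha(i)}$ is any irreducible element of $\mathfrak m$ such that the strict transform on $X$ of the curve $Q_{\alpha(i)}=0$ is smooth and meets $E_{\alpha(i)}$ transversely at a nonsingular point of $E$. A general curve of $V$ is a reduced curve $C=\bigcup_{i=1}^rC_i$ with $r$ branches, each $C_i$ defined by an equation $Q_{\alpha(i)}=0$. The sets $V^{(k)}$: $\pi^{(0)}$ is the minimal resolution of $V$; for $k\ge1$, $\pi^{(k)}$ with exceptional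 divisor $E^{(k)}$ is the composition of $\pi^{(k-1)}$ with $r$ additional blow-ups, one at each point where the strict transform of $C$ meets $E^{(k-1)}$. $E_{\alpha^{(k)}(i)}$ is the component of $E^{(k)}$ meeting the strict transform of $C_i$, $\nu_i^{(k)}$ is the $E_{\alpha^{(k)}(i)}$-valuation, and $V^{(k)}=\{\nu^{(k)}_1,\dots,\nu_r^{(k)}\}$ (so $V^{(0)}=V$). For $\underline m\in\mathbb Z^r$, $\underline t^{\underline m}=t_1^{m_1}\cdots t_r^{m_r}$; $\underline e=(1,\dots,1)$. $\mathcal L=\mathbb Z[[t_1,t_1^{-1},\dots,t_r,t_r^{-1}]]$ is the set of formal Laurent series $\sum_{\underline m\in\mathbb Z^r}a_{\underline m}\underline t^{\underline m}$, a $\mathbb Z[t_1,\dots,t_r]$-module. For a set $W=\{\omega_1,\dots,\omega_r\}$ of divisorial valuations, let $J(\underline m)=\{g\in R\mid\omega_i(g)\ge m_i\ \forall i\}$, $d(\underline m)=\dim_KJ(\underline m)/J(\underline m+\underline e)$, $L_W=\sum_{\underline m\in\mathbb Z^r}d(\underline m)\underline t^{\underline m}\in\mathcal L$, $P'_W=L_W\cdot\prod_{i=1}^r(t_i-1)$, which lies in $\mathbb Z[[t_1,\dots,t_r]]$, and $P_W=P'_W/(t_1\cdots t_r-1)\in\mathbb Z[[t_1,\dots,t_r]]$. For the reduced curve $C$ with $C_i$ defined by $f_i$, $\mathcal O=R/(f_1\cdots f_r)$, let $v_i(g)$ be the order of the image of $g$ in the normalization of $R/(f_i)$ ($\infty$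 if $g\in(f_i)$), $J^C(\underline m)=\{g\in\mathcal O\mid v_i(g)\ge m_i\ \forall i\}$, $c(\underline m)=\dim_KJ^C(\underline m)/J^C(\underline m+\underline e)$, $L_C=\sum_{\underline m\in\mathbb Z^r}c(\underline m)\underline t^{\underline m}$, $P'_C=L_C\cdot\prod_{i=1}^r(t_i-1)$ (known to be a polynomial divisible by $t_1\cdots t_r-1$) and $P_C=P'_C/(t_1\cdots t_r-1)$. The limit is taken in the formal power series ring $\mathbb Z[[t_1,\dots,t_r]]$, coefficient by coefficient. *)

(* Defs.v *)
From HB Require Import structures.
From mathcomp Require Import all_boot all_order all_algebra.
From mathcomp Require Import boolp classical_sets constructive_ereal.

Set Implicit Arguments.
Unset Strict Implicit.
Unset Printing Implicit Defensive.

Import Order.TTheory GRing.Theory Num.Theory.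
Local Open Scope classical_set_scope.
Local Open Scope ring_scope.

(** * Subrings of a commutative ring and their ideals, as sets

    Below, [A] is a subring of the ambient ring [S], given as a set; for the
    ring [S] itself take [A := setT]. *)

Section Ideals.
Variable S : comNzRingType.
Implicit Types (A p q : set S) (x y z : S).

Definition is_subring A : Prop :=
  [/\ A 1, (forall x y, A x -> A y -> A (x - y))
         & (forall x y, A x -> A y -> A (x * y))].

Definition is_ideal A q : Prop :=
  [/\ q `<=` A, q 0, (forall x y, q x -> q y -> q (x + y))
              & (forall a x, A a -> q x -> q (a * x))].

Definition prime_ideal A q : Prop :=
  [/\ is_ideal A q, ~ q 1
    & (forall x y, A x -> A y -> q (x * y) -> q x \/ q y)].

Definition maximal_ideal A q : Prop :=
  [/\ is_ideal A q, ~ q 1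
    & (forall p, is_ideal A p -> ~ p 1 -> q `<=` p -> p = q)].

Definition units A : set S :=
  [set x | A x /\ exists2 y, A y & x * y = 1].

(* This is the maximal ideal when [A] is local. *)
Definition nonunits A : set S := A `\` units A.

Definition ideal1 A z : set S := [set a * z | a in A].
Definition ideal2 A z w : set S := [set a * z + b * w | a in A & b in A].

Definition ideal_span A n (g : 'I_n -> S) : set S :=
  [set x | exists2 a : 'I_n -> S, (forall j, A (a j))
                                & x = \sum_j a j * g j].

Definition ideal_pow A q (n : nat) : set S :=
  [set x | exists N (g : 'I_N -> S),
     (forall j, exists2 s : 'I_n -> S, (forall l, q (s l))
                                     & g j = \prod_l s l)
     /\ ideal_span A g x].

End Ideals.

(** * The base ring *)

Section RegularLocal.
Variable R : comNzRingType.

Definition noetherian : Prop :=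
  forall q : set R, is_ideal setT q ->
    exists n (g : 'I_n -> R), q = ideal_span setT g.

Definition has_prime_chain (n : nat) : Prop :=
  exists p : nat -> set R,
    (forall i, (i <= n)%N -> prime_ideal setT (p i)) /\
    (forall i, (i < n)%N -> p i `<` p i.+1).

Definition krull_dim (n : nat) : Prop :=
  has_prime_chain n /\ ~ has_prime_chain n.+1.

Let m : set R := nonunits setT.

(* Separated, and every Cauchy sequence (normalised so that consecutive terms
   [a n], [a n.+1] agree modulo [m ^ n]) has a limit. *)
Definition adically_complete : Prop :=
  (forall x, (forall n, ideal_pow setT m n x) -> x = 0) /\
  (forall a : nat -> R,
     (forall n, ideal_pow setT m n (a n.+1 - a n)) ->
     exists l, forall n, ideal_pow setT m n (l - a n)).

Definition complete_regular_local2 : Prop :=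
  [/\ is_ideal setT m, noetherian, krull_dim 2,
      (exists x y, m = ideal2 setT x y) & adically_complete].

Definition coefficient_field (K : fieldType) (iota : {rmorphism K -> R}) :
  Prop := forall a : R, exists c : K, m (a - iota c).

End RegularLocal.

(** * Divisorial valuations

    A valuation of a field [F] is a function [F -> \bar int]; the value [+oo]
    is taken exactly at 0. *)

Definition discrete_valuation (F : fieldType) (v : F -> \bar int) : Prop :=
  [/\ v 0 = +oo%E,
      (forall x, x != 0 -> exists n : int, v x = n%:E),
      (forall n : int, exists2 x, x != 0 & v x = n%:E),
      (forall x y, v (x * y) = (v x + v y)%E)
    & (forall x y, (Order.min (v x) (v y) <= v (x + y)%R)%E)].

Section Valuations.
Variables (K : fieldType) (R : idomainType) (iota : {rmorphism K -> R}).
Local Notation F := {fraction R}.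

Definition centered (v : F -> \bar int) : Prop :=
  (forall a : R, (0 <= v (tofrac a))%E) /\
  (forall a : R, (0 < v (tofrac a))%E <-> nonunits setT a).

Definition eval1 (u : F) (p : {poly K}) : F :=
  (map_poly (@tofrac R \o iota) p).[u].
Definition eval2 (u w : F) (p : {poly {poly K}}) : F :=
  (map_poly (eval1 u) p).[w].

(* The residue field of [v] has transcendence degree 1 over that of [R], i.e.
   over [K]: some residue is transcendental, any two residues are
   algebraically dependent. *)
Definition residual_trdeg1 (v : F -> \bar int) : Prop :=
  (exists2 u, (0 <= v u)%E &
     forall p, p != 0 -> ~ (0 < v (eval1 u p))%E) /\
  (forall u w, (0 <= v u)%E -> (0 <= v w)%E ->
     exists2 p, p != 0 & (0 < v (eval2 u w p))%E).

Definition divisorial_valuation (v : F -> \bar int) : Prop :=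
  [/\ discrete_valuation v, centered v & residual_trdeg1 v].

End Valuations.

(* The order function of a discrete valuation ring [W] with fraction field [F]:
   [ordv W (t ^ n * u) = n] for a uniformizer [t] and a unit [u] of [W]. *)
Definition ordv (F : fieldType) (W : set F) (x : F) : \bar int :=
  if x == 0 then +oo%E else
  (xget 0 [set n : int | exists t u,
     [/\ nonunits W = ideal1 W t, units W u & x = t ^ n * u]])%:E.

(** * Modifications

    A modification [X] of [Spec R] is integral, separated and birational over
    [Spec R], so a point of [X] is determined by its local ring, which is a
    subring of the fraction field [F] of [R].  [X] is represented (as in
    Zariski's models) by the local rings of its closed points above the closed
    point of [Spec R], and by the local rings at the generic points of the
    irreducible components of its exceptional divisor.

    A prime divisor of [X] (exceptional component or strict transform of a
    branch) is thus given by the local ring [W] of its generic point.  Since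
    [X] is separated, it contains the closed point [T] iff [T `<=` W], and its
    ideal in [T] is [divisor_ideal T W]. *)

Definition localize (F : fieldType) (A q : set F) : set F :=
  [set a / b | a in A & b in A `\` q].

Definition divisor_ideal (F : fieldType) (T W : set F) : set F :=
  T `&` nonunits W.

Section Blowup.
Variable F : fieldType.
Implicit Types (T W A : set F).

(* The affine chart [T[m/z]] of the blow-up of the local ring [(T, m)]; the
   exceptional divisor has ideal [ideal1 (chart T z) z] there. *)
Definition chart T (z : F) : set F :=
  smallest (@is_subring F) (T `|` [set x / z | x in nonunits T]).

Definition exceptional_point T : set (set F) :=
  [set T' | exists z q, [/\ nonunits T z, z != 0,
     maximal_ideal (chart T z) q, q z & T' = localize (chart T z) q]].

Definition exceptional_generic_point T : set (set F) :=
  [set W | exists z, [/\ nonunits T z, z != 0,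
     prime_ideal (chart T z) (ideal1 (chart T z) z)
     & W = localize (chart T z) (ideal1 (chart T z) z)]].

Record model := Model {
  closed_points : set (set F);
  exc_components : set (set F)
}.

(* Blow-up of all the points of a finite set [Z] of closed points of [X]. *)
Definition blowup (X : model) (Z : set (set F)) : model :=
  Model ((closed_points X `\` Z) `|` \bigcup_(T in Z) exceptional_point T)
        (exc_components X `|` \bigcup_(T in Z) exceptional_generic_point T).

(* [X'] dominates [X]: the birational map from [X'] to [X] is a morphism. *)
Definition dominates (X' X : model) : Prop :=
  forall T', closed_points X' T' -> exists T,
    [/\ closed_points X T, T `<=` T' & nonunits T `<=` nonunits T'].

(* The reduced divisor with ideal [I] in the two-dimensional regular local
   ring [T] is nonsingular at the closed point of [T]. *)
Definition nonsingular_at T (I : set F) : Prop :=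
  exists z w, nonunits T = ideal2 T z w /\ I = ideal1 T z.

(* The ideal at [T] of the total exceptional divisor of [X], as a reduced
   curve. *)
Definition exc_ideal (X : model) T : set F :=
  [set x | T x /\ forall W, exc_components X W -> T `<=` W -> nonunits W x].

Definition transverse_at T W W' : Prop :=
  nonunits T =
  [set x + y | x in divisor_ideal T W & y in divisor_ideal T W'].

End Blowup.

Section Resolution.
Variable R : idomainType.
Local Notation F := {fraction R}.
Implicit Types (X Y : model F) (Q : R).

Definition base_ring : set F := range (@tofrac R).

Inductive modification : model F -> Prop :=
| modification_first :
    modification (blowup (Model [set base_ring] set0) [set base_ring])
| modification_next X (T : set F) :
    modification X -> closed_points X T -> modification (blowup X [set T]).

Definition is_valuation_of_component X (W : set F) (v : F -> \bar int) : Prop :=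
  exc_components X W /\ v =1 ordv W.

Definition resolves r (nu : 'I_r -> F -> \bar int) X : Prop :=
  modification X /\
  forall i, exists W, is_valuation_of_component X W (nu i).

Definition minimal_resolution r (nu : 'I_r -> F -> \bar int) X : Prop :=
  resolves nu X /\ forall Y, resolves nu Y -> dominates Y X.

Definition irreducible_elt Q : Prop :=
  [/\ Q != 0, Q \isn't a GRing.unit
    & forall a b, Q = a * b -> a \is a GRing.unit \/ b \is a GRing.unit].

Definition multiples Q : set R := ideal1 setT Q.

(* The local ring of [Spec R] at the generic point of the curve [Q = 0]. *)
Definition branch_ring Q : set F :=
  localize base_ring (@tofrac R @` multiples Q).

Definition curvette X (W : set F) Q : Prop :=
  [/\ irreducible_elt Q,
      (forall T, closed_points X T -> T `<=` branch_ring Q ->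
         nonsingular_at T (divisor_ideal T (branch_ring Q)))
    & exists T, [/\ closed_points X T, T `<=` branch_ring Q, T `<=` W,
         nonsingular_at T (exc_ideal X T)
       & transverse_at T (branch_ring Q) W]].

(* [f i = 0] defines the branch [C_i]; [X] is the minimal resolution. *)
Definition general_curve r (nu : 'I_r -> F -> \bar int) X (f : 'I_r -> R) :
  Prop :=
  (forall i, exists2 W, is_valuation_of_component X W (nu i)
                      & curvette X W (f i)) /\
  (forall i j, i != j -> multiples (f i) <> multiples (f j)).

(* The points where the strict transform of the curve meets the exceptional
   divisor: every closed point of a modification lies on the latter. *)
Definition curve_points r (f : 'I_r -> R) X : set (set F) :=
  [set T | closed_points X T /\ exists i, T `<=` branch_ring (f i)].

Definition iterated_blowup r (f : 'I_r -> R) X (k : nat) : model F :=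
  iter k (fun Y => blowup Y (curve_points f Y)) X.

Definition meets_branch X (W : set F) Q : Prop :=
  exists T, [/\ closed_points X T, T `<=` W & T `<=` branch_ring Q].

(* [nus k i] is the valuation of the component of the k-th blow-up that meets
   the strict transform of [f i = 0]. *)
Definition approaching_valuations r X (f : 'I_r -> R)
    (nus : nat -> 'I_r -> F -> \bar int) : Prop :=
  forall k i, exists2 W,
    is_valuation_of_component (iterated_blowup f X k) W (nus k i)
    & meets_branch (iterated_blowup f X k) W (f i).

End Resolution.

(** * Formal Laurent series

    A series in [r] variables is its coefficient function. *)

Section Series.
Variable r : nat.

Definition laurent := 'rV[int]_r -> int.

Definition mul_t_sub1 (i : 'I_r) (a : laurent) : laurent :=
  fun m => a (m - delta_mx 0 i) - a m.

Definition mul_prod_t_sub1 (a : laurent) : laurent :=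
  foldr mul_t_sub1 a (enum 'I_r).

(* Multiplication by [t_1 ... t_r - 1]. *)
Definition mul_T_sub1 (a : laurent) : laurent :=
  fun m => a (m - const_mx 1) - a m.

Definition is_power_series (a : laurent) : Prop :=
  forall m, a m != 0 -> forall i, 0 <= m 0 i.

(* The quotient by [t_1 ... t_r - 1] in the ring of formal power series; it
   exists and is unique when [a] is a power series, as [t_1 ... t_r - 1] is
   then invertible. *)
Definition div_T_sub1 (a : laurent) : laurent :=
  xget (fun=> 0) [set b : laurent | is_power_series b /\ mul_T_sub1 b = a].

Definition coefficientwise_limit (a : nat -> laurent) (b : laurent) : Prop :=
  forall m, exists k0, forall k, (k0 <= k)%N -> a k m = b m.

End Series.

(** * Poincare series *)

(* [n] is the dimension over [K] of [U / U'], for [K]-subspaces [U'] of [U] of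
   the ring [A], where [K] acts through [j]. *)
Definition is_quot_dim (K : fieldType) (A : nzRingType) (j : K -> A)
    (U U' : set A) (n : nat) : Prop :=
  exists2 b : 'I_n -> A, (forall l, U (b l)) &
    forall x, U x -> exists! c : 'rV[K]_n, U' (x - \sum_l j (c 0 l) * b l).

(* By convention 0 in infinite dimension. *)
Definition quot_dim (K : fieldType) (A : nzRingType) (j : K -> A)
    (U U' : set A) : nat :=
  xget 0%N [set n | is_quot_dim j U U' n].

Definition valuation_ideal (A : nzRingType) r (v : 'I_r -> A -> \bar int)
    (m : 'rV[int]_r) : set A :=
  [set g | forall i, ((m 0 i)%:E <= v i g)%E].

Definition laurent_series (K : fieldType) (A : nzRingType) (j : K -> A) r
    (v : 'I_r -> A -> \bar int) : laurent r :=
  fun m => (quot_dim j (valuation_ideal v m)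
                       (valuation_ideal v (m + const_mx 1)))%:Z.

Definition poincare_series (K : fieldType) (A : nzRingType) (j : K -> A) r
    (v : 'I_r -> A -> \bar int) : laurent r :=
  div_T_sub1 (mul_prod_t_sub1 (laurent_series j v)).

Definition divisorial_poincare_series (K : fieldType) (R : idomainType)
    (iota : {rmorphism K -> R}) r (nu : 'I_r -> {fraction R} -> \bar int) :
  laurent r :=
  poincare_series iota (fun i g => nu i (tofrac g)).

(** * The ring of the curve, and the normalizations of its branches *)

(* [rho] presents [O] as [R / (f_1 ... f_r)]. *)
Definition curve_ring (R : idomainType) r (f : 'I_r -> R) (O : comNzRingType)
    (rho : {rmorphism R -> O}) : Prop :=
  (forall h, exists g, rho g = h) /\
  (forall g, rho g = 0 <-> multiples (\prod_i f i) g).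

(* [phi] presents [L] as the fraction field of [O / (rho Q) = R / (Q)]. *)
Definition branch_field (R : idomainType) (O : comNzRingType)
    (rho : {rmorphism R -> O}) (Q : R) (L : fieldType)
    (phi : {rmorphism O -> L}) : Prop :=
  (forall h, phi h = 0 <-> ideal1 setT (rho Q) h) /\
  (forall x, exists a b, phi b != 0 /\ x = phi a / phi b).

(* The normalization of the image of [phi] in its fraction field [L]. *)
Definition normalization (O : comNzRingType) (L : fieldType)
    (phi : {rmorphism O -> L}) : set L :=
  [set x | integralOver phi x].

Definition branch_order (O : comNzRingType) (L : fieldType)
    (phi : {rmorphism O -> L}) (h : O) : \bar int :=
  ordv (normalization phi) (phi h).

Definition curve_poincare_series (K : fieldType) (R : idomainType)
    (iota : {rmorphism K -> R}) (O : comNzRingType) (rho : {rmorphism R -> O})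
    r (L : 'I_r -> fieldType) (phi : forall i, {rmorphism O -> L i}) :
  laurent r :=
  poincare_series (rho \o iota) (fun i => branch_order (phi i)).

(* Main.v *)
(** Write [x] and [y] for the equations of the exceptional component and of the
    branch [C_i] at the point of [X] on [C_i].  The point of the [k]-th blow-up
    on [C_i] has parameters [x] and [y / x ^ k], so that the new component, of
    equation [x], has value [k] on [y].  An element [g] of [R] with [v_i g = n]
    is [u x ^ n + b y] with [u] a unit; hence its value along the new component
    is [n] if [n < k], and at least [k] if [n >= k].  Therefore the ideal
    [J (m)] of [V^(k)] is the inverse image of the ideal [J^C (m)] as soon as
    all [m_i <= k], the series [L] agree up to that order, and so do the
    series [P], whose coefficient at [m] only involves exponents below [m].

    It remains to see that for large [k] the components through the point of
    the [k]-th blow-up on [C_i] are as described: an element of the maximal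
    ideal of [R] not vanishing on [C_i] is there a power of [x] times a unit,
    so [x] vanishes on the component, and [y / x ^ k] does not since the
    blow-up is separated.  Completeness of [R] identifies the strict transform
    of [C_i] at that point with the normalization of the branch. *)
Require Import Defs.
From mathcomp Require Import all_boot all_order all_algebra.
From mathcomp Require Import boolp classical_sets constructive_ereal.
From mathcomp Require Import generic_quotient zify ring.

Set Implicit Arguments.
Unset Strict Implicit.
Unset Printing Implicit Defensive.

Import Order.TTheory GRing.Theory Num.Theory.
Local Open Scope classical_set_scope.
Local Open Scope ring_scope.

(** * Power series *)

(** The local rings of the blown-up points are never shown to be noetherian. Their regularity is
    carried by [regular_pair]: two generators of the maximal ideal whose only syzygies are Koszul's.
    This passes to the closed points of a blow-up, because the special fibre of the chart [T[w / z]]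
    is a polynomial ring in [w / z]. The price is that two separation statements, usually instances
    of Krull's intersection theorem, need their own arguments. In the ring that a point cuts out on
    the branch, a parameter of [R / f] divisible by all powers of the uniformizer is excluded by
    counting dimensions over [K]. At the point itself, an element divisible by all powers of [x]
    vanishes on the branch, hence is divisible by all powers of the local equation of the branch,
    and separatedness of [R] makes it zero. The parameter [x] can be kept through all the blow-ups
    because it restricts to a uniformizer of the branch, so that the next point on the branch always
    lies in the chart where [x] generates the exceptional ideal. *)

Section SeriesLemmas.
Variable r : nat.
Implicit Types (a b : laurent r) (m : 'rV[int]_r) (i : 'I_r).

Definition agree_below m a b : Prop :=
  forall m', (forall i, m' 0 i <= m 0 i) -> a m' = b m'.

Lemma agree_below_mul_t m a b i :
  agree_below m a b -> agree_below m (mul_t_sub1 i a) (mul_t_sub1 i b).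
Proof.
move=> ab m' le_m'; rewrite /mul_t_sub1 !ab // => j.
by rewrite !mxE eqxx; have := le_m' j; case: (j == i) => /=; lia.
Qed.

Lemma agree_below_mul_prod m a b :
  agree_below m a b -> agree_below m (mul_prod_t_sub1 a) (mul_prod_t_sub1 b).
Proof.
rewrite /mul_prod_t_sub1 => ab; elim: (enum 'I_r) => //= i s.
exact: agree_below_mul_t.
Qed.

(* [(t_i - 1) a] vanishes where the [i]-th exponent is negative. *)
Definition flat_below i a : Prop :=
  forall m, m 0 i < 0 -> a (m - delta_mx 0 i) = a m.

(** The factor [t_i - 1] kills everything with negative [i]-th exponent, and the other factors
    preserve both flatness and vanishing there; the induction over the factors therefore carries the
    two properties together. *)
Lemma is_power_series_mul_prod a :
  (forall i, flat_below i a) -> is_power_series (mul_prod_t_sub1 a).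
Proof.
move=> flat_a m nz i; rewrite leNgt; apply: contraNN nz => mi_lt0; apply/eqP.
have lt0 (j : 'I_r) m' : m' 0 i < 0 -> (m' - delta_mx 0 j) 0 i < 0.
  by rewrite !mxE; case: (_ && _) => /=; lia.
have [_] : flat_below i (mul_prod_t_sub1 a) /\
  (i \in enum 'I_r -> forall m', m' 0 i < 0 -> mul_prod_t_sub1 a m' = 0).
  rewrite /mul_prod_t_sub1; elim: (enum 'I_r) => [|j s [flat_s van_s]] /=.
    by split.
  split=> [m' m'_lt0|]; rewrite /mul_t_sub1.
    rewrite flat_s // addrAC flat_s //; exact: lt0.
  rewrite inE => /orP[/eqP <-|i_s] m' m'_lt0; first by rewrite flat_s ?subrr.
  by rewrite !van_s ?subrr //; exact: lt0.
by apply=> //; rewrite mem_enum.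
Qed.

Lemma const_mx_subE m n i : (m - const_mx n) 0 i = m 0 i - n.
Proof. by rewrite !mxE. Qed.

Hypothesis r_gt0 : (0 < r)%N.
Let i0 : 'I_r := Ordinal r_gt0.

Lemma div_T_sub1P a : is_power_series a ->
  is_power_series (div_T_sub1 a) /\ mul_T_sub1 (div_T_sub1 a) = a.
Proof.
move=> ps_a; rewrite /div_T_sub1; case: xgetP => [b -> //|no]; exfalso.
have a_lt0 m i : m 0 i < 0 -> a m = 0.
  by move=> m_lt0; apply/eqP; apply: contraLR m_lt0 => /ps_a; rewrite -leNgt.
(* The inverse of [T - 1] is [-(1 + T + T^2 + ...)]; [N m] cuts the sum where the coordinate [i0]
   becomes negative, from where on [a] vanishes. *)
pose N m := if m 0 i0 is Posz n then n.+1 else 0%N.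
pose b m : int := - \sum_(0 <= j < N m) a (m - const_mx j%:Z).
apply: (no b); split=> [m nz i|].
  rewrite leNgt; apply: contraNN nz => m_lt0; rewrite /b big1 ?oppr0 // => j _.
  by apply: (a_lt0 _ i); rewrite const_mx_subE; lia.
apply/funext => m; rewrite /mul_T_sub1 /b opprK.
have shiftE (j : nat) : m - const_mx 1 - const_mx j%:Z = m - const_mx j.+1%:Z.
  by apply/rowP => i; rewrite !mxE; lia.
have -> : \sum_(0 <= j < N (m - const_mx 1)) a (m - const_mx 1 - const_mx j%:Z)
    = \sum_(0 <= j < N (m - const_mx 1)) a (m - const_mx j.+1%:Z).
  apply: eq_bigr => j _; congr (a _); exact: shiftE.
have [N0|[n [Nm N1]]] :
    [/\ N m = 0%N, N (m - const_mx 1) = 0%N & m 0 i0 < 0] \/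
    exists n, N m = n.+1 /\ N (m - const_mx 1) = n.
- rewrite /N const_mx_subE; case: (m 0 i0) => [[|n]|n]; [right|right|left].
  + by exists 0%N.
  + by exists n.+1; split; last by have -> : n.+1%:Z - 1 = n%:Z by lia.
  + by have -> : Negz n - 1 = Negz n.+1 by lia.
- by case: N0 => -> -> m_lt0; rewrite !big_geq // (a_lt0 m i0) ?oppr0 ?addr0.
by rewrite N1 Nm [X in - _ + X]big_nat_recl // subr0 addrCA addNr addr0.
Qed.

Lemma agree_below_div m a b : is_power_series a -> is_power_series b ->
  agree_below m a b -> div_T_sub1 a m = div_T_sub1 b m.
Proof.
move=> /div_T_sub1P[psa aE] /div_T_sub1P[psb bE]; rewrite -{1}aE -{1}bE.
move: (div_T_sub1 a) (div_T_sub1 b) psa psb {aE bE} => {}a {}b psa psb ab.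
(* The difference of the two quotients is constant along the diagonal going down from [m], where it
   ends at negative exponents and thus at 0. *)
have ind n : a m - b m = a (m - const_mx n%:Z) - b (m - const_mx n%:Z).
  elim: n => [|n ->]; first by rewrite !subr0.
  have := ab (m - const_mx n%:Z); rewrite /mul_T_sub1.
  have -> : m - const_mx n%:Z - const_mx 1 = m - const_mx n.+1%:Z.
    by apply/rowP => i; rewrite !mxE; lia.
  have h : forall i, (m - const_mx n%:Z) 0 i <= m 0 i.
    by move=> i; rewrite const_mx_subE; lia.
  by move=> /(_ h); lia.
pose n := (absz (m 0 i0)).+1; have neg : (m - const_mx n%:Z) 0 i0 < 0.
  by rewrite const_mx_subE /n; lia.
have van c : is_power_series c -> c (m - const_mx n%:Z) = 0.
  by move=> psc; apply/eqP; apply: contraLR neg => /psc; rewrite -leNgt.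
by have := ind n; rewrite !van //; lia.
Qed.

Lemma poincare_limit (a : nat -> laurent r) b k0 :
  (forall k i, (k0 <= k)%N -> flat_below i (a k)) ->
  (forall i, flat_below i b) ->
  (forall k m, (k0 <= k)%N -> (forall i, m 0 i < k%:Z) -> a k m = b m) ->
  coefficientwise_limit (fun k => div_T_sub1 (mul_prod_t_sub1 (a k)))
                        (div_T_sub1 (mul_prod_t_sub1 b)).
Proof.
move=> flat_a flat_b ab m.
exists (k0 + \sum_i (absz (m 0%R i)).+1)%N => k le_k.
apply: agree_below_div; [|exact: is_power_series_mul_prod|].
  by apply: is_power_series_mul_prod => i; apply: flat_a; lia.
apply: agree_below_mul_prod => m' le_m'; apply: ab => [|i]; first by lia.
have := le_m' i; have : ((absz (m 0%R i)).+1 <= \sum_i (absz (m 0%R i)).+1)%N.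
  by rewrite (bigD1 i) //= leq_addr.
lia.
Qed.

End SeriesLemmas.

(** * Dimensions of quotients under a surjection *)

Section QuotDim.
Variables (K : fieldType) (A B : comNzRingType).
Variables (j : {rmorphism K -> A}) (p : {rmorphism A -> B}).

(** A family is a basis of the quotient upstairs iff its image is one downstairs. Comparing the sets
    of admissible dimensions, rather than the dimensions, also covers the default value in infinite
    dimension. *)
Lemma quot_dim_preimage (U U' : set B) : (forall y, exists x, p x = y) ->
  quot_dim j (p @^-1` U) (p @^-1` U') = quot_dim (p \o j) U U'.
Proof.
move=> surj; rewrite /quot_dim; congr xget; apply/seteqP.
have pE n (b : 'I_n -> A) (c : 'rV[K]_n) x :
    p (x - \sum_l j (c 0 l) * b l)
    = p x - \sum_l (p \o j) (c 0 l) * p (b l).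
  rewrite rmorphB rmorph_sum; congr (_ - _).
  by apply: eq_bigr => l _; rewrite rmorphM.
split=> n [b Ub hb].
  exists (p \o b) => // y; have [x <-] := surj y => Ux.
  have [c [cU cuniq]] := hb x Ux; exists c; split; first by rewrite -pE.
  by move=> c' Uc'; apply: cuniq; rewrite /= pE.
have /choice[b' b'E] : forall l, exists x, p x = b l by move=> l; apply: surj.
exists b' => [l|x Ux]; first by rewrite /= b'E.
have [c [cU cuniq]] := hb _ Ux; exists c.
have sumE c' : \sum_l (p \o j) (c' 0 l) * p (b' l)
              = \sum_l (p \o j) (c' 0 l) * b l.
  by apply: eq_bigr => l _; rewrite b'E.
split=> [|c']; rewrite /= pE sumE //.
exact: cuniq.
Qed.

End QuotDim.

(** * Complete regular local rings *)

Section LocalNoetherian.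
Variable R : idomainType.
Implicit Types (a b c u x y : R) (p q I J : set R).
Local Notation m := (@nonunits R setT).

Lemma unitsTP a : units setT a <-> a \is a GRing.unit.
Proof.
split=> [[_ [b _ ab1]]|ua]; last by split=> //; exists a^-1; rewrite ?mulrV.
by apply/unitrPr; exists b.
Qed.

Lemma nonunitsTP a : m a <-> a \isn't a GRing.unit.
Proof.
by split=> [[_ /unitsTP/negP]|/negP nu] //; split=> // /unitsTP.
Qed.

Lemma unitVnonunit a : a \is a GRing.unit \/ m a.
Proof. by case: (boolP (a \is a GRing.unit)) => [|/nonunitsTP]; [left|right]. Qed.

Lemma ideal_sub I x y : is_ideal setT I -> I x -> I y -> I (x - y).
Proof. by case=> _ _ ID IM Ix Iy; rewrite -mulN1r; apply/ID/IM. Qed.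

Lemma ideal_sum I n (F : 'I_n -> R) :
  is_ideal setT I -> (forall i, I (F i)) -> I (\sum_i F i).
Proof. by case=> _ I0 ID _ IF; apply: (@big_ind _ I) => // *; apply: ID. Qed.

Lemma ideal2_genl x y : ideal2 setT x y x.
Proof. by exists 1 => //; exists 0 => //; rewrite mul1r mul0r addr0. Qed.

Lemma ideal2_genr x y : ideal2 setT x y y.
Proof. by exists 0 => //; exists 1 => //; rewrite mul1r mul0r add0r. Qed.

Hypothesis m_ideal : is_ideal setT m.

Lemma unit_sub_nonunit u a :
  u \is a GRing.unit -> m a -> u - a \is a GRing.unit.
Proof.
move=> uu ma; case: (unitVnonunit (u - a)) => // mua.
have [_ _ mD _] := m_ideal; have := mD _ _ mua ma.
by rewrite subrK => /nonunitsTP; rewrite uu.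
Qed.

(** Elimination of one generator: [1 - x * c ord0] is a unit, so modulo [J] the first generator is
    [x] times a combination of the others, and substituting it leaves a system of the same form. *)
Lemma nakayama_gen x J n (g : 'I_n -> R) : m x -> is_ideal setT J ->
  (forall i, exists2 c : 'I_n -> R, J (g i - x * \sum_j c j * g j) & True) ->
  forall i, J (g i).
Proof.
move=> mx iJ; have [_ _ JD JM] := iJ.
elim: n g => [|n IHn] g gJ; first by case.
have [c Jc _] := gJ ord0.
have [c' Jc'] : exists c' : 'I_n -> R, J (g ord0 - x * \sum_j c' j * g (lift ord0 j)).
  have u : 1 - x * c ord0 \is a GRing.unit.
    apply: unit_sub_nonunit (unitr1 _) _.
    by have [_ _ _ mM] := m_ideal; rewrite mulrC; apply: mM.
  exists (fun j => (1 - x * c ord0)^-1 * c (lift ord0 j)).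
  have -> : \sum_j (1 - x * c ord0)^-1 * c (lift ord0 j) * g (lift ord0 j)
    = (1 - x * c ord0)^-1 * \sum_j c (lift ord0 j) * g (lift ord0 j).
    by rewrite mulr_sumr; apply: eq_bigr => j _; rewrite mulrA.
  move: Jc; rewrite big_ord_recl; set s := \sum_(i < n) _ => Jc.
  have -> : g ord0 - x * ((1 - x * c ord0)^-1 * s) =
      (1 - x * c ord0)^-1 * (g ord0 - x * (c ord0 * g ord0 + s)).
    apply: (mulrI u); rewrite [RHS]mulVKr // mulrBr [in LHS](mulrCA x) mulVKr //.
    by ring.
  exact: JM.
have Jlift i : J (g (lift ord0 i)).
  apply: (IHn (fun i => g (lift ord0 i))) => {}i.
  have [d Jd _] := gJ (lift ord0 i).
  exists (fun j => d (lift ord0 j) + x * d ord0 * c' j) => //.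
  have -> : \sum_j (d (lift ord0 j) + x * d ord0 * c' j) * g (lift ord0 j)
    = \sum_j d (lift ord0 j) * g (lift ord0 j)
      + x * d ord0 * \sum_j c' j * g (lift ord0 j).
    rewrite mulr_sumr -big_split; apply: eq_bigr => j _ /=.
    by rewrite mulrDl !mulrA.
  move: Jd Jc'; rewrite big_ord_recl; set s := \sum_(j < n) _.
  set s' := \sum_(j < n) _ => Jd Jc'.
  have := JD _ _ Jd (JM (x * d ord0) _ I Jc').
  by congr J; ring.
move=> i; case: (unliftP ord0 i) => [j ->|->]; first exact: Jlift.
rewrite -[g ord0](subrK (x * \sum_j c' j * g (lift ord0 j))).
apply: JD => //; apply: (JM) => //; apply: (ideal_sum iJ) => j.
exact: JM.
Qed.

Lemma nakayama x I J : noetherian R -> m x -> is_ideal setT I ->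
  is_ideal setT J -> (forall a, I a -> exists2 c, I c & J (a - x * c)) ->
  I `<=` J.
Proof.
move=> noeth mx iI iJ IJ; have [n [g gE]] := noeth _ iI.
have Ig i : I (g i).
  rewrite gE; exists (fun j => (j == i)%:R) => //.
  rewrite (bigD1 i) //= eqxx mul1r big1 ?addr0 // => j /negPf->.
  by rewrite mul0r.
have Jg i : J (g i).
  apply: (nakayama_gen mx iJ) => {}i; have [c Ic Jc] := IJ _ (Ig i).
  by move: Ic; rewrite gE => -[a _ cE]; exists a; rewrite -?cE.
have [_ _ _ JM] := iJ.
by move=> a; rewrite gE => -[c _ ->]; apply: (ideal_sum iJ) => j; exact: JM.
Qed.

Variables x y : R.
Hypothesis mE : m = ideal2 setT x y.

Let mxy : m x /\ m y.
Proof.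
by rewrite mE; split; [exact: ideal2_genl | exact: ideal2_genr].
Qed.

Lemma adic_expansion N a :
  (exists u i c, [/\ u \is a GRing.unit, (i < N)%N & a = u * y ^+ i + c * x])
  \/ (exists b c, a = b * y ^+ N + c * x).
Proof.
elim: N => [|N [[u [i [c [uu iN ->]]]]|[b [c ->]]]].
- by right; exists a, 0; rewrite expr0 mulr1 mul0r addr0.
- by left; exists u, i, c; split=> //; exact: ltnW.
case: (unitVnonunit b) => [ub|].
  by left; exists b, N, c; split.
rewrite mE => -[d _ [e _ <-]]; right; exists e, (c + d * y ^+ N).
by rewrite exprS; ring.
Qed.

(** The argument of Krull's principal ideal theorem. [I k] is the saturation by [x] of the ideal
    generated by [p] and [b ^ k]. Modulo [x] it is described by the least power [y ^ l k] that it
    contains, and [l k <= n] since [y ^ n] is in [p] modulo [x]; so [l k.+1 = l k] for some [k].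
    Then [I k] lies in [I k.+1 + x (I k)], where saturation puts the cofactor of [x] back into
    [I k]. Nakayama gives [I k = I k.+1], which contains [b ^ k], and [b ^ k] cancels modulo the
    prime [p]. *)
Lemma krull_height1 p n c b : noetherian R -> prime_ideal setT p ->
  p (y ^+ n - c * x) -> ~ p b -> exists j c, p (x ^+ j - c * b).
Proof.
move=> noeth [ip np1 pP] pyn npb; have [_ p0 pD pM] := ip.
pose I k := [set a | exists j d, p (x ^+ j * a - d * b ^+ k)].
have pI k : p `<=` I k.
  by move=> a pa; exists 0%N, 0; rewrite mul0r subr0; apply: pM.
have iI k : is_ideal setT (I k).
  split=> // [|a a' [j [d h]] [j' [d' h']]|a a' _ [j [d h]]]; first exact: pI.
    exists (j + j')%N, (x ^+ j' * d + x ^+ j * d').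
    have := pD _ _ (pM (x ^+ j') _ Logic.I h) (pM (x ^+ j) _ Logic.I h').
    by congr p; rewrite exprD; ring.
  by exists j, (a * d); have := pM a _ Logic.I h; congr p; ring.
have II k : I k.+1 `<=` I k.
  by move=> a [j [d h]]; exists j, (d * b); move: h; rewrite exprS mulrA.
pose J k i := `[< exists a d, I k a /\ y ^+ i = a + d * x >].
have Jn k : J k n.
  by apply/asboolP; exists (y ^+ n - c * x), c; rewrite subrK; split=> //; apply: pI.
have exJ k : exists i, J k i by exists n.
pose l k := ex_minn (exJ k).
have lP k : J k (l k) by rewrite /l; case: ex_minnP.
have lmin k i : J k i -> (l k <= i)%N.
  by rewrite /l; case: ex_minnP => i0 _ h /h.
have [k lk] : exists k, l k.+1 = l k.
  apply: contrapT => nk; have lt k : (k <= l k)%N.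
    elim: k => // k IHk; apply: leq_ltn_trans IHk _.
    rewrite ltn_neqAle; apply/andP; split.
      by apply/eqP => e; apply: nk; exists k.
    apply: lmin; apply/asboolP; have /asboolP[a [d [Ia h]]] := lP k.+1.
    by exists a, d; split=> //; apply: II.
  by have := lt n.+1; have := lmin _ _ (Jn n.+1); lia.
have step a : I k a -> exists2 d, I k d & I k.+1 (a - x * d).
  move=> Ia; suff [d Id] : exists d, I k.+1 (a - x * d).
    exists d => //; have [j [e]] : I k (x * d).
      have -> : x * d = a - (a - x * d) by ring.
      by apply: ideal_sub => //; apply: II.
    by rewrite mulrA -exprSr; exists j.+1, e.
  have [_ _ ID IM] := iI k; have [_ _ _ IM'] := iI k.+1.
  have [[u [i [d [uu _ aE]]]]|[d [e aE]]] := adic_expansion n a.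
    have: J k i.
      apply/asboolP; exists (u^-1 * a), (- (u^-1 * d)); split; first exact: IM.
      by rewrite aE mulrDr mulKr // mulNr mulrA addrK.
    move=> /lmin; rewrite -lk => li; have /asboolP[a' [e [Ia' h]]] := lP k.+1.
    exists (d + u * y ^+ (i - l k.+1) * e).
    have := IM' (u * y ^+ (i - l k.+1)) _ Logic.I Ia'; congr (I k.+1).
    rewrite aE; have -> : y ^+ i = y ^+ (i - l k.+1) * y ^+ l k.+1.
      by rewrite -exprD subnK.
    by rewrite h; ring.
  exists (e + d * c); apply: pI; have := pM d _ Logic.I pyn.
  by congr p; rewrite aE; ring.
have Ib : I k (b ^+ k) by exists 0%N, 1; rewrite expr0 subrr.
have [j [d h]] := nakayama noeth (proj1 mxy) (iI k) (iI k.+1) step Ib.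
exists j, d; have: p ((x ^+ j - d * b) * b ^+ k).
  by move: h; congr p; rewrite exprS; ring.
case/pP=> // pbk; exfalso; apply: npb; elim: k pbk {lk step h Ib} => [//|k IHk].
by rewrite exprS => /pP[] // /IHk.
Qed.

Lemma prime_ideal_exp p n a : prime_ideal setT p -> p (a ^+ n) -> p a.
Proof.
case=> _ np1 pP; elim: n => [//|n IHn].
by rewrite exprS => /pP[] // /IHn.
Qed.

Lemma zero_ideal_prime : prime_ideal setT [set 0 : R].
Proof.
split=> [|/eqP|a b _ _ /eqP]; last by rewrite mulf_eq0 => /orP[]/eqP; [left|right].
  split=> // [a b -> ->|a b _ ->]; [exact: addr0 | exact: mulr0].
by rewrite oner_eq0.
Qed.

(** Otherwise [krull_height1], applied to the zero ideal, puts [x] and then [y] into every nonzero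
    prime; [p 1] would already be maximal, against the chain of length 2. *)
Lemma parameter_power n c : noetherian R -> has_prime_chain R 2 ->
  y ^+ n <> c * x.
Proof.
move=> noeth [p [p_prime p_lt]] yn.
have [_ /existsNP[b /not_implyP[pb nb]]] := p_lt 0%N isT.
have [[_ p00 _ _] _ _] := p_prime 0%N isT.
have b0 : ~ [set 0] b by move=> b0; apply: nb; rewrite b0.
have [|j [d]] := krull_height1 (n := n) (c := c) noeth zero_ideal_prime _ b0.
  by rewrite yn subrr.
move=> /eqP; rewrite subr_eq0 => /eqP xj.
have [[_ _ p1D p1M] _ _] := p_prime 1%N isT.
have p1x : p 1%N x.
  by apply: (prime_ideal_exp (p_prime 1%N isT) (n := j)); rewrite xj; apply: p1M.
have p1y : p 1%N y.
  by apply: (prime_ideal_exp (p_prime 1%N isT) (n := n)); rewrite yn; apply: p1M.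
have [_ /existsNP[a /not_implyP[pa na]]] := p_lt 1%N isT.
have [[_ _ _ p2M] np1 _] := p_prime 2%N isT.
have [ua|] := unitVnonunit a.
  by apply: np1; rewrite -(mulVr ua); apply: p2M.
by rewrite mE => -[d' _ [e' _ aE]]; apply: na; rewrite -aE; apply: p1D; apply: p1M.
Qed.

End LocalNoetherian.

Section IdealPower.
Variables (R : idomainType) (q : set R).

Lemma ideal_pow_mulX n a h : q h -> ideal_pow setT q n (a * h ^+ n).
Proof.
move=> qh; exists 1%N, (fun=> h ^+ n); split=> [_|].
  by exists (fun=> h) => //; rewrite prodr_const card_ord.
by exists (fun=> a) => //; rewrite big_ord1.
Qed.

Lemma ideal_pow_mul n a b :
  ideal_pow setT q n b -> ideal_pow setT q n (a * b).
Proof.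
move=> [N [g [qg [c _ ->]]]]; exists N, g; split=> //.
exists (fun j => a * c j) => //; rewrite mulr_sumr.
by apply: eq_bigr => j _; rewrite mulrA.
Qed.

Lemma ideal_pow_add n a b : ideal_pow setT q n a -> ideal_pow setT q n b ->
  ideal_pow setT q n (a + b).
Proof.
move=> [N [g [qg [c _ ->]]]] [M [h [qh [d _ ->]]]].
pose glue (u : 'I_N -> R) (v : 'I_M -> R) (k : 'I_(N + M)) :=
  match split k with inl i => u i | inr i => v i end.
have glueL u v i : glue u v (lshift M i) = u i.
  by rewrite /glue (unsplitK (inl i)).
have glueR u v i : glue u v (rshift N i) = v i.
  by rewrite /glue (unsplitK (inr i)).
exists (N + M)%N, (glue g h); split=> [k|].
  by rewrite /glue; case: split => i; [exact: qg | exact: qh].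
exists (glue c d) => //; rewrite big_split_ord /=.
by congr (_ + _); apply: eq_bigr => i _; rewrite ?glueL ?glueR.
Qed.

End IdealPower.

Section CompleteRegular.
Variable R : idomainType.
Local Notation m := (@nonunits R setT).
Implicit Types (a b c u x y g h : R).
Hypothesis hR : complete_regular_local2 R.

Lemma power_series_limit h (s : nat -> R) : m h ->
  exists l, forall N, ideal_pow setT m N (l - \sum_(j < N) s j * h ^+ j).
Proof.
case: hR => _ _ _ _ [_ cvg] mh; apply: cvg => N.
by rewrite big_ord_recr /= addrAC subrr add0r; apply: ideal_pow_mulX.
Qed.

(** [R / x] is a discrete valuation ring with uniformizer [y]. If no unit ever appears in the
    repeated division by [y], the multiples of [x] split off on the way form a Cauchy series whose
    sum is [a]. *)
Lemma complete_dichotomy x y a : m = ideal2 setT x y ->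
  (exists u i c, u \is a GRing.unit /\ a = u * y ^+ i + c * x)
  \/ (exists c, a = c * x).
Proof.
move=> mE; case: (pselect (exists u i c, u \is a GRing.unit /\
  a = u * y ^+ i + c * x)) => [|na]; [by left|right].
pose S b := forall u i c, u \is a GRing.unit -> b <> u * y ^+ i + c * x.
have Sa : S a by move=> u i c uu aE; apply: na; exists u, i, c.
have /choice[f fP] b : exists cb : R * R,
    S b -> S cb.2 /\ b = cb.1 * x + cb.2 * y.
  case: (pselect (S b)) => [Sb|]; last by exists (0, 0).
  have [ub|] := unitVnonunit b.
    by case: (Sb b 0%N 0 ub); rewrite expr0 mulr1 mul0r addr0.
  rewrite mE => -[c _ [d _ bE]]; exists (c, d) => _; split=> //= u i e uu dE.
  by apply: (Sb u i.+1 (c + e * y) uu); rewrite -bE exprS dE; ring.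
pose b n := iter n (fun b => (f b).2) a.
have Sb n : S (b n) by elim: n => // n /fP[].
have my : m y by rewrite mE; exact: ideal2_genr.
have [l lP] := power_series_limit (fun n => (f (b n)).1) my.
exists l; apply/eqP; rewrite -subr_eq0; apply/eqP.
case: (hR) => _ _ _ _ [sep _]; apply: sep => N.
have aE : a = (\sum_(j < N) (f (b j)).1 * y ^+ j) * x + b N * y ^+ N.
  elim: N => [|N {1}->]; first by rewrite big_ord0 mul0r expr0 mulr1 add0r.
  have -> : b N * y ^+ N = ((f (b N)).1 * x + b N.+1 * y) * y ^+ N.
    by rewrite {1}(proj2 (fP _ (Sb N))).
  by rewrite big_ord_recr /= exprS; ring.
rewrite {1}aE.
have -> : forall s t u v : R, s * t + u - v * t = - t * (v - s) + u.
  by move=> *; ring.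
by apply: ideal_pow_add; [apply: ideal_pow_mul | apply: ideal_pow_mulX].
Qed.

Lemma parameter_power_neq x y n c : m = ideal2 setT x y -> y ^+ n <> c * x.
Proof.
case: hR => m_ideal noeth [chain _] _ _ mE.
exact: (parameter_power m_ideal mE).
Qed.

Lemma regular_syzygy x y a b : m = ideal2 setT x y ->
  a * x = b * y -> exists c, b = c * x.
Proof.
move=> mE ab; case: (complete_dichotomy b mE) => // -[u [i [c [uu bE]]]].
exfalso; apply: (@parameter_power_neq x y i.+1 (u^-1 * (a - c * y)) mE).
apply: (mulrI uu); rewrite !mulrA mulrV // mul1r mulrBl ab bE exprS.
by ring.
Qed.

Lemma ideal2C (A : set R) x y : ideal2 A x y = ideal2 A y x.
Proof.
by apply/seteqP; split=> _ [a Aa [b Ab <-]]; exists b => //; exists a => //;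
  rewrite addrC.
Qed.

(* Weierstrass preparation in disguise: a branch is finite over the line
   with coordinate [x], unless that line is the branch itself. *)
Lemma weierstrass_coordinates g : irreducible_elt g ->
  exists x y n c d, m = ideal2 setT x y /\ y ^+ n = c * g + d * x.
Proof.
case: (hR) => _ _ _ [x [y mE]] _ [g0 gnu girr].
have [mx my] : m x /\ m y.
  by rewrite mE; split; [exact: ideal2_genl | exact: ideal2_genr].
case: (complete_dichotomy g mE) => [[u [i [c [uu gE]]]]|[c gE]].
  exists x, y, i, u^-1, (- u^-1 * c); split=> //.
  by rewrite gE mulrDr mulKr // !mulNr mulrA addrK.
have mE' : m = ideal2 setT y x by rewrite mE ideal2C.
case: (complete_dichotomy g mE') => [[u [i [d [uu gE']]]]|[d gE']].
  exists y, x, i, u^-1, (- u^-1 * d); split=> //.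
  by rewrite gE' mulrDr mulKr // !mulNr mulrA addrK.
have [uc|] := girr _ _ gE; last by move: mx => /nonunitsTP/negPf->.
have [ud|] := girr _ _ gE'; last by move: my => /nonunitsTP/negPf->.
exfalso; apply: (@parameter_power_neq x y 1 (d^-1 * c) mE).
by rewrite expr1 -mulrA -gE gE' mulKr.
Qed.

End CompleteRegular.

(** * Local subrings of a field and domination *)

Section Subrings.
Variable F : fieldType.
Implicit Types (A T V q : set F) (a b c u x y : F).

Section Closure.
Variable T : set F.
Hypothesis hT : is_subring T.

Lemma sub1 : T 1. Proof. by case: hT. Qed.
Lemma subB x y : T x -> T y -> T (x - y). Proof. by case: hT => _ + _; apply. Qed.
Lemma subM x y : T x -> T y -> T (x * y). Proof. by case: hT => _ _; apply. Qed.
Lemma sub0 : T 0. Proof. by rewrite -(subrr 1); apply: subB; exact: sub1. Qed.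
Lemma subN x : T x -> T (- x).
Proof. by rewrite -sub0r => Tx; apply: subB => //; exact: sub0. Qed.
Lemma subD x y : T x -> T y -> T (x + y).
Proof. by move=> Tx Ty; rewrite -[y]opprK; apply: subB => //; exact: subN. Qed.
Lemma subX x n : T x -> T (x ^+ n).
Proof.
by move=> Tx; elim: n => [|n IHn]; [exact: sub1 | rewrite exprS; exact: subM].
Qed.
Lemma sub_sum (I : Type) (s : seq I) (P : pred I) (f : I -> F) :
  (forall i, T (f i)) -> T (\sum_(i <- s | P i) f i).
Proof.
by move=> Tf; apply: (@big_ind _ T) => // *; [exact: sub0 | exact: subD].
Qed.

Lemma unitsP x : units T x <-> [/\ T x, x != 0 & T x^-1].
Proof.
split=> [[Tx [y Ty xy1]]|[Tx x0 TVx]]; last by split=> //; exists x^-1; rewrite ?divff.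
have x0 : x != 0 by apply: contra_eqN xy1 => /eqP->; rewrite mul0r eq_sym oner_eq0.
by split=> //; rewrite -[x^-1]mulr1 -xy1 mulKf.
Qed.

Lemma unit_or_nonunit x : T x -> units T x \/ nonunits T x.
Proof. by move=> Tx; case: (pselect (units T x)); [left | right]. Qed.

Lemma units_mul x y : units T x -> units T y -> units T (x * y).
Proof.
move=> /unitsP[Tx x0 TVx] /unitsP[Ty y0 TVy]; apply/unitsP.
by split; rewrite ?mulf_neq0 ?invfM //; exact: subM.
Qed.

Lemma units_inv x : units T x -> units T x^-1.
Proof.
by move=> /unitsP[Tx x0 TVx]; apply/unitsP; rewrite invrK invr_neq0.
Qed.

Lemma units_one : units T 1.
Proof. by apply/unitsP; rewrite invr1 oner_eq0; split=> //; exact: sub1. Qed.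

Lemma nonunits_sub x : nonunits T x -> T x. Proof. by case. Qed.

Lemma nonunits_mul a x : T a -> nonunits T x -> nonunits T (a * x).
Proof.
move=> Ta [Tx nux]; split; first exact: subM.
move=> /unitsP[_]; rewrite mulf_eq0 negb_or invfM => /andP[a0 x0] TV.
apply: nux; apply/unitsP; split=> //.
by rewrite -[x^-1](mulVKf a0); apply: subM.
Qed.

Lemma nonunits1 : ~ nonunits T 1.
Proof. by case=> _; apply; exact: units_one. Qed.

Lemma nonunits0 : nonunits T 0.
Proof. by split; [exact: sub0 | move=> /unitsP[_]; rewrite eqxx]. Qed.

Lemma nonunit_unit x : units T x -> ~ nonunits T x.
Proof. by move=> ux [_]. Qed.

End Closure.

Definition local_subring T : Prop :=
  is_subring T /\
  (forall x y, nonunits T x -> nonunits T y -> nonunits T (x + y)).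

Definition dominated T V : Prop :=
  T `<=` V /\ nonunits T `<=` nonunits V.

Lemma dominated_trans T1 T2 T3 :
  dominated T1 T2 -> dominated T2 T3 -> dominated T1 T3.
Proof. by case=> s12 n12 [s23 n23]; split=> x => [/s12/s23|/n12/n23]. Qed.

Lemma units_incl T V x : is_subring T -> is_subring V -> T `<=` V ->
  units T x -> units V x.
Proof.
by move=> hT hV TV /unitsP[/TV ? ? /TV ?]; apply/unitsP.
Qed.

Lemma dominated_unit T V x : is_subring T -> dominated T V ->
  T x -> units V x -> units T x.
Proof.
move=> hT [_ nTV] Tx uVx.
by case: (unit_or_nonunit Tx) => // /nTV/nonunit_unit.
Qed.

Section Local.
Variable T : set F.
Hypothesis lT : local_subring T.
Let hT : is_subring T := proj1 lT.

Lemma nonunits_add x y : nonunits T x -> nonunits T y -> nonunits T (x + y).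
Proof. by case: lT => _; apply. Qed.

Lemma nonunits_opp x : nonunits T x -> nonunits T (- x).
Proof.
by move=> nx; rewrite -mulN1r; apply: nonunits_mul => //; apply: subN => //; exact: sub1.
Qed.

Lemma nonunits_subr x y : nonunits T x -> nonunits T y -> nonunits T (x - y).
Proof. by move=> nx ny; apply: nonunits_add => //; exact: nonunits_opp. Qed.

Lemma nonunits_exp x n : nonunits T x -> nonunits T (x ^+ n.+1).
Proof.
move=> nx; rewrite exprSr; apply: nonunits_mul => //.
by apply: subX => //; exact: nonunits_sub nx.
Qed.

Lemma units_add u x : units T u -> nonunits T x -> units T (u + x).
Proof.
move=> uu nx; have Tu : T u by case: uu.
have Tx := nonunits_sub nx.
case: (unit_or_nonunit (subD hT Tu Tx)) => // nux.
by case: (nonunit_unit uu); rewrite -(addrK x u); exact: nonunits_subr.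
Qed.

Lemma units_sub u x : units T u -> nonunits T x -> units T (u - x).
Proof. by move=> uu nx; apply: units_add => //; exact: nonunits_opp. Qed.

End Local.

Lemma ideal2_gen T z w : is_subring T -> ideal2 T z w z /\ ideal2 T z w w.
Proof.
move=> hT; have [T0 T1] := (sub0 hT, sub1 hT).
split; first by exists 1 => //; exists 0 => //; rewrite mul1r mul0r addr0.
by exists 0 => //; exists 1 => //; rewrite mul1r mul0r add0r.
Qed.

(** * Localization at a prime ideal *)

Section Localization.
Variables (A q : set F).
Hypotheses (hA : is_subring A) (qP : prime_ideal A q).
Local Notation Aq := (localize A q).

Let q0 : q 0. Proof. by case: qP => -[]. Qed.
Let qM a x : A a -> q x -> q (a * x). Proof. by case: qP => -[_ _ _ h] _ _; exact: h. Qed.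
Let qD x y : q x -> q y -> q (x + y). Proof. by case: qP => -[_ _ h _] _ _; exact: h. Qed.

Lemma notin_prime_neq0 b : ~ q b -> b != 0.
Proof. by move=> nqb; apply: contra_notN nqb => /eqP->. Qed.

Lemma localize_in a b : A a -> A b -> ~ q b -> Aq (a / b).
Proof. by move=> Aa Ab nqb; exists a => //; exists b. Qed.

Lemma localize_incl : A `<=` Aq.
Proof.
move=> a Aa; rewrite -[a]divr1; apply: localize_in => //; first exact: sub1.
by case: qP.
Qed.

Lemma notin_prime_mul b d : A b -> A d -> ~ q b -> ~ q d -> ~ q (b * d).
Proof. by move=> Ab Ad nb nd; case: qP => _ _ /(_ b d Ab Ad) h /h[]. Qed.

Lemma localize_subring : is_subring Aq.
Proof.
split; first by apply: localize_incl; exact: sub1.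
- move=> _ _ [a Aa [b [Ab nb] <-]] [c Ac [d [Ad nd] <-]].
  have -> : a / b - c / d = (a * d - c * b) / (b * d).
    by field; rewrite (notin_prime_neq0 nb) (notin_prime_neq0 nd).
  by apply: localize_in; [apply: subB => //; exact: subM | exact: subM |
                          exact: notin_prime_mul].
- move=> _ _ [a Aa [b [Ab nb] <-]] [c Ac [d [Ad nd] <-]].
  have -> : a / b * (c / d) = (a * c) / (b * d).
    by field; rewrite (notin_prime_neq0 nb) (notin_prime_neq0 nd).
  by apply: localize_in; [exact: subM | exact: subM | exact: notin_prime_mul].
Qed.

Lemma localize_nonunit a b : A a -> A b -> ~ q b ->
  nonunits Aq (a / b) <-> q a.
Proof.
move=> Aa Ab nb; split=> [[_ nu]|qa].
  apply: contrapT => na; apply: nu; apply/unitsP.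
  split; [exact: localize_in| |rewrite invf_div; exact: localize_in].
  by rewrite mulf_neq0 ?invr_neq0 ?notin_prime_neq0.
split; first exact: localize_in.
move=> [_ [_ [c Ac [d [Ad nd] <-]]]].
have -> : a / b * (c / d) = (a * c) / (b * d).
  by field; rewrite (notin_prime_neq0 nb) (notin_prime_neq0 nd).
move/(canRL (divfK (notin_prime_neq0 (notin_prime_mul Ab Ad nb nd)))).
rewrite mul1r => e; apply: (notin_prime_mul Ab Ad nb nd).
by rewrite -e mulrC; apply: qM.
Qed.

Lemma localize_nonunit_incl a : A a -> nonunits Aq a <-> q a.
Proof.
move=> Aa; rewrite -{1}[a]divr1; apply: localize_nonunit => //; first exact: sub1.
by case: qP.
Qed.

Lemma localize_local : local_subring Aq.
Proof.
split=> [|x y nx ny]; first exact: localize_subring.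
have [[a Aa [b [Ab nb] xE]] _] := nx; have [[c Ac [d [Ad nd] yE]] _] := ny.
move: nx ny; rewrite -xE -yE => /(localize_nonunit Aa Ab nb) qa.
move=> /(localize_nonunit Ac Ad nd) qc.
have -> : a / b + c / d = (d * a + b * c) / (b * d).
  by field; rewrite (notin_prime_neq0 nb) (notin_prime_neq0 nd).
apply/localize_nonunit; [|exact: subM|exact: notin_prime_mul|].
  by apply: subD => //; exact: subM.
by apply: qD; exact: qM.
Qed.

Lemma localize_unit b : A b -> ~ q b -> units Aq b.
Proof.
move=> Ab nb; apply/unitsP.
split; [exact: localize_incl|exact: notin_prime_neq0|].
by rewrite -div1r; apply: localize_in => //; exact: sub1.
Qed.

End Localization.

Lemma maximal_ideal_inv A q a : is_subring A -> maximal_ideal A q ->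
  A a -> ~ q a -> exists2 g, A g & q (1 - g * a).
Proof.
move=> hA [[qA q0 qD qM] nq1 qmax] Aa nqa.
pose p := [set x + g * a | x in q & g in A].
have A0 := sub0 hA.
have pI : is_ideal A p.
  split.
  - move=> _ [x qx [g Ag <-]]; apply: subD => //; [exact: qA | exact: subM].
  - by exists 0 => //; exists 0 => //; rewrite mul0r addr0.
  - move=> _ _ [x qx [g Ag <-]] [y qy [h Ah <-]]; exists (x + y); first exact: qD.
    by exists (g + h); [exact: subD | ring].
  - move=> b _ Ab [x qx [g Ag <-]]; exists (b * x); first exact: qM.
    by exists (b * g); [exact: subM | ring].
case: (pselect (p 1)) => [[x qx [g Ag e]]|np1].
  by exists g => //; rewrite -e addrK.
have qp : q `<=` p by move=> x qx; exists x => //; exists 0 => //; rewrite mul0r addr0.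
case: nqa; rewrite -(qmax _ pI np1 qp).
by exists 0 => //; exists 1; [exact: sub1 | rewrite mul1r add0r].
Qed.

Lemma maximal_ideal_prime A q : is_subring A -> maximal_ideal A q ->
  prime_ideal A q.
Proof.
move=> hA mq; have [[qA q0 qD qM] nq1 _] := mq; split=> // x y Ax Ay qxy.
case: (pselect (q x)) => [|nqx]; [by left|right].
have [g Ag qg] := maximal_ideal_inv hA mq Ax nqx.
have -> : y = y * (1 - g * x) + g * (x * y) by ring.
by apply: qD; exact: qM.
Qed.

(** * Points of a blow-up *)

Lemma chart_subring T z : is_subring (chart T z).
Proof.
split=> [A [[]]//|x y cx cy A hA|x y cx cy A hA].
  by apply: (subB (proj1 hA)); [exact: cx | exact: cy].
by apply: (subM (proj1 hA)); [exact: cx | exact: cy].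
Qed.

Lemma chart_incl T z : T `<=` chart T z.
Proof. by move=> x Tx; apply: sub_gen_smallest; left. Qed.

Lemma chart_div T z x : nonunits T x -> chart T z (x / z).
Proof. by move=> nx; apply: sub_gen_smallest; right; exists x. Qed.

Lemma chart_least T z A : is_subring A -> T `<=` A ->
  (forall x, nonunits T x -> A (x / z)) -> chart T z `<=` A.
Proof.
move=> hA TA divA; apply: smallest_sub => // x [/TA//|[y ny <-]].
exact: divA.
Qed.

(* [T'] is the local ring of the blow-up of [T] at a point, closed or not,
   of the exceptional divisor. *)
Definition infinitely_near T T' : Prop := exists z q,
  [/\ nonunits T z, z != 0, prime_ideal (chart T z) q, q z
    & T' = localize (chart T z) q].

Lemma exceptional_point_near T T' :
  exceptional_point T T' -> infinitely_near T T'.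
Proof.
move=> [z [q [nz z0 qmax qz T'E]]]; exists z, q; split=> //.
by apply: maximal_ideal_prime => //; exact: chart_subring.
Qed.

Lemma exceptional_generic_near T W :
  exceptional_generic_point T W -> infinitely_near T W.
Proof.
move=> [z [nz z0 qP WE]]; exists z, (ideal1 (chart T z) z); split=> //.
by exists 1; [exact: sub1 (chart_subring T z) | rewrite mul1r].
Qed.

Section Near.
Variables T T' : set F.
Hypothesis TT' : infinitely_near T T'.

Lemma near_local : local_subring T'.
Proof.
case: TT' => z [q [_ _ qP _ ->]].
by apply: localize_local => //; exact: chart_subring.
Qed.

Lemma near_dominated : dominated T T'.
Proof.
case: TT' => z [q [nz z0 qP qz ->]]; have cS := chart_subring T z.
have qM := qP; case: qM => -[_ _ _ qM] _ _.
split=> x => [Tx|nx]; first by apply: (localize_incl cS qP); exact: chart_incl.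
apply/(localize_nonunit_incl cS qP); first by apply: chart_incl; case: nx.
by rewrite -(divfK z0 x); apply: qM => //; exact: chart_div.
Qed.

End Near.

(** The quotient [z' / z] of the two exceptional equations lies in [L] and its inverse in [L'], so
    it is a unit of [V], and by domination a unit of [L]. Hence [L] contains the chart of [z'], and
    again by domination the denominators of [L'] are units of [L]. *)
Lemma near_incl T L L' V : is_subring V ->
  infinitely_near T L -> infinitely_near T L' ->
  dominated L V -> dominated L' V -> L' `<=` L.
Proof.
move=> hV TL TL' LV L'V; have [hL _] := near_local TL.
have [hL' _] := near_local TL'.
have [TLi _] := near_dominated TL.
case: (TL) => z [q [nz z0 qP qz LE]]; case: (TL') => z' [q' [nz' z0' qP' qz' LE']].
have cS := chart_subring T z; have cS' := chart_subring T z'.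
have Lz'z : L (z' / z) by rewrite LE; apply: (localize_incl cS qP); apply: chart_div.
have L'zz' : L' (z / z') by rewrite LE'; apply: (localize_incl cS' qP'); apply: chart_div.
have Lzz' : L (z / z').
  have : units L (z' / z).
    apply: (dominated_unit hL LV) => //; apply/unitsP.
    rewrite mulf_neq0 ?invr_neq0 // invf_div.
    by split=> //; [exact: (proj1 LV) | exact: (proj1 L'V)].
  by move/unitsP => -[_ _]; rewrite invf_div.
have cL : chart T z' `<=` L.
  apply: chart_least => // x nx.
  have -> : x / z' = (x / z) * (z / z') by field; rewrite z0 z0'.
  by apply: subM => //; rewrite LE; apply: (localize_incl cS qP); apply: chart_div.
rewrite LE' => _ [a ca [b [cb nb] <-]]; apply: subM => //; first exact: cL.
have ub : units L' b by rewrite LE'; exact: localize_unit.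
have /unitsP[] // : units L b.
apply: (dominated_unit hL LV); first exact: cL.
exact: units_incl (proj1 L'V) ub.
Qed.

(* A blow-up is separated. *)
Lemma near_unique T L L' V : is_subring V ->
  infinitely_near T L -> infinitely_near T L' ->
  dominated L V -> dominated L' V -> L = L'.
Proof. by move=> *; apply/seteqP; split; apply: near_incl; eassumption. Qed.

End Subrings.

(** * Regular parameters and the structure of a chart *)

Section RegularPoints.
Variable F : fieldType.
Implicit Types (T V q : set F) (a b c u x y z w : F) (P Q : {poly F}).

Lemma eq_of_sub_eq a b c d : c = d -> a - b = c - d -> a = b.
Proof. by move=> -> /eqP; rewrite subrr subr_eq0 => /eqP. Qed.

(* A regular system of parameters: Koszul's relation is the only syzygy. *)
Definition regular_pair T z w : Prop :=
  [/\ nonunits T = ideal2 T z w, z != 0, w != 0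
    & forall a b, T a -> T b -> a * z = b * w -> T (b / z)].

(** The coefficients of a syzygy of [z, w] are nonunits ([syz0]), so the transition matrices between
    the two pairs are inverse to each other modulo the maximal ideal, and the determinant [D] is a
    unit. *)
Lemma regular_pair_change T z w x y : local_subring T -> regular_pair T z w ->
  nonunits T = ideal2 T x y -> regular_pair T x y.
Proof.
move=> lT [mE z0 w0 syz] mE'; have hT := proj1 lT.
have [mz mw] : nonunits T z /\ nonunits T w by rewrite mE; exact: ideal2_gen.
have [mx my] : nonunits T x /\ nonunits T y by rewrite mE'; exact: ideal2_gen.
have syz0 a b : T a -> T b -> a * z = b * w -> nonunits T a /\ nonunits T b.
  move=> Ta Tb ab; have Tc := syz _ _ Ta Tb ab.
  have -> : a = (b / z) * w by rewrite mulrAC -ab mulfK.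
  by rewrite -{2}(divfK z0 b); split; apply: nonunits_mul.
move: (mx) (my); rewrite mE => -[a Ta [b Tb xE]] [c Tc [d Td yE]].
move: (mz) (mw); rewrite mE' => -[p Tp [q Tq zE]] [r Tr [s Ts wE]].
have zE' : p * (a * z + b * w) + q * (c * z + d * w) = z by rewrite xE yE.
have wE' : r * (a * z + b * w) + s * (c * z + d * w) = w by rewrite xE yE.
have TM := subM hT; have TD := subD hT; have TB := subB hT.
have [n1 n2] : nonunits T (p * a + q * c - 1) /\ nonunits T (- (p * b + q * d)).
  apply: syz0; [|by apply: subN => //; apply: TD; apply: TM|].
    by apply: TB; [apply: TD; apply: TM | exact: sub1].
  by apply: eq_of_sub_eq zE' _; ring.
have [n3 n4] : nonunits T (r * a + s * c) /\ nonunits T (1 - (r * b + s * d)).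
  apply: syz0; [by apply: TD; apply: TM| |].
    by apply: TB; [exact: sub1 | apply: TD; apply: TM].
  by apply: eq_of_sub_eq wE' _; ring.
pose D := a * d - b * c; have TDD : T D by apply: TB; apply: TM.
have uD : units T D.
  case: (unit_or_nonunit TDD) => // nD; exfalso; apply: (nonunits1 hT).
  have -> : 1 = (p * s - q * r) * D
     + - (r * b + s * d) * (p * a + q * c - 1)
     + (1 - (r * b + s * d))
     + (- (r * a + s * c)) * (- (p * b + q * d)) by rewrite /D; ring.
  apply: nonunits_add => //; last first.
    by apply: nonunits_mul => //; apply: subN => //; apply: TD; apply: TM.
  apply: nonunits_add => //; apply: nonunits_add => //.
    by apply: nonunits_mul => //; apply: TB; apply: TM.
  by apply: nonunits_mul => //; apply: subN => //; apply: TD; apply: TM.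
have /unitsP[_ D0 TVD] := uD.
have x0 : x != 0.
  apply/eqP => x_eq0; have [||n5 n6] := syz0 a (- b) Ta; first exact: subN.
    by apply/eqP; rewrite mulNr -subr_eq0 opprK xE x_eq0.
  apply: (nonunit_unit uD); rewrite /D.
  have -> : a * d - b * c = d * a + c * - b by ring.
  by apply: nonunits_add => //; apply: nonunits_mul.
have y0 : y != 0.
  apply/eqP => y_eq0; have [||n5 n6] := syz0 c (- d) Tc; first exact: subN.
    by apply/eqP; rewrite mulNr -subr_eq0 opprK yE y_eq0.
  apply: (nonunit_unit uD); rewrite /D.
  have -> : a * d - b * c = (- a) * - d + (- b) * c by ring.
  by apply: nonunits_add => //; apply: nonunits_mul => //; apply: subN.
split=> // al be Tal Tbe ab.
pose e := be * d - al * b; have Te : T e by apply: TB; apply: TM.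
have eE : (al * a - be * c) * z = e * w.
  apply/eqP; rewrite -subr_eq0; apply/eqP.
  have -> : (al * a - be * c) * z - e * w
    = al * (a * z + b * w) - be * (c * z + d * w) by rewrite /e; ring.
  by rewrite xE yE ab subrr.
have Tez : T (e / z) by apply: (syz (al * a - be * c)) => //; apply: TB; apply: TM.
have -> : be / x = (e / z) * D^-1.
  apply: (mulIf x0); rewrite divfK //; apply: (mulfI D0).
  have -> : D * be = a * e + b * (al * a - be * c) by rewrite /D /e; ring.
  have -> : al * a - be * c = e / z * w by rewrite mulrAC -eE mulfK.
  rewrite -xE; field; rewrite z0 D0 //.
by apply: TM.
Qed.

Lemma coef_consP (S : set F) P c :
  (forall i, S (P * 'X + c%:P)`_i) <-> (forall i, S P`_i) /\ S c.
Proof.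
split=> [h|[hP hc] i]; last by rewrite coefD coefMX coefC; case: i => [|i];
  rewrite /= ?add0r ?addr0.
split=> [i|].
  by have := h i.+1; rewrite coefD coefMX coefC /= addr0.
by have := h 0%N; rewrite coefD coefMX coefC /= add0r.
Qed.

Section Chart.
Variables (T : set F) (z w : F).
Hypotheses (lT : local_subring T) (mE : nonunits T = ideal2 T z w).
Hypothesis z0 : z != 0.
Local Notation t := (w / z).

Let hT : is_subring T := proj1 lT.
Let mz : nonunits T z. Proof. by rewrite mE; have [] := ideal2_gen z w hT. Qed.
Let mw : nonunits T w. Proof. by rewrite mE; have [] := ideal2_gen z w hT. Qed.
Let cS : is_subring (chart T z). Proof. exact: chart_subring. Qed.

Lemma horner_chart P : (forall i, T P`_i) -> chart T z P.[t].
Proof.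
move=> TP; rewrite horner_coef; apply: (sub_sum cS) => i.
by apply: (subM cS); [exact: chart_incl | apply: (subX cS); exact: chart_div].
Qed.

Lemma chartP g : chart T z g -> exists2 P : {poly F}, (forall i, T P`_i) & g = P.[t].
Proof.
have T0 := sub0 hT; have T1 := sub1 hT.
apply: (@chart_least _ T z [set g | exists2 P : {poly F}, (forall i, T P`_i) & g = P.[t]]).
- split.
  + by exists 1 => [i|]; rewrite ?hornerC // coefC; case: i.
  + move=> _ _ [P hP ->] [Q hQ ->]; exists (P - Q); last by rewrite hornerD hornerN.
    by move=> i; rewrite coefB; apply: subB.
  + move=> _ _ [P hP ->] [Q hQ ->]; exists (P * Q); last by rewrite hornerM.
    by move=> i; rewrite coefM; apply: (sub_sum hT) => j; apply: subM.
- by move=> x Tx; exists x%:P => [i|]; rewrite ?hornerC // coefC; case: i.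
- move=> x; rewrite mE => -[a Ta [b Tb <-]].
  exists (b%:P * 'X + a%:P).
    by apply/coef_consP; split=> // i; rewrite coefC; case: i.
  by rewrite hornerMXaddC hornerC; field.
Qed.

Lemma horner_nonunits P : (forall i, nonunits T P`_i) ->
  exists2 g, chart T z g & P.[t] = z * g.
Proof.
move=> nP; exists (P.[t] / z); last by rewrite [RHS]mulrC divfK.
rewrite horner_coef mulr_suml; apply: (sub_sum cS) => i.
rewrite mulrAC; apply: (subM cS); first exact: chart_div.
by apply: (subX cS); exact: chart_div.
Qed.

Hypothesis syz : regular_pair T z w.
Let w0 : w != 0. Proof. by case: syz. Qed.

Lemma horner_clear P : (forall i, T P`_i) -> exists n, T (z ^+ n * P.[t]).
Proof.
elim/poly_ind: P => [|P c IHP]; first by exists 0%N; rewrite horner0 mulr0; exact: sub0.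
move=> /coef_consP[/IHP[n TP] Tc]; exists n.+1; rewrite hornerMXaddC.
have -> : z ^+ n.+1 * (P.[t] * t + c) = (z ^+ n * P.[t]) * w + z ^+ n.+1 * c.
  by rewrite exprS; field.
have Tw := nonunits_sub mw; have Tz := nonunits_sub mz.
by apply: subD => //; apply: subM => //; exact: subX.
Qed.

Lemma regular_pair_div n c : T c -> T (z ^+ n * c / w) -> T (c / w).
Proof.
have [_ _ _ h] := syz; move=> Tc.
elim: n => [|n IHn]; first by rewrite mul1r.
move=> Te; apply: IHn.
have -> : z ^+ n * c / w = (z ^+ n.+1 * c / w) / z by rewrite exprS; field; rewrite z0 w0.
apply: (h (z ^+ n * c)) => //.
  by apply: subM => //; apply: subX => //; exact: nonunits_sub mz.
by rewrite divfK // exprS; ring.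
Qed.

(** All relations come from [z X - w]. If [P X + c] vanishes at [w / z], clearing denominators shows
    that [w] divides [c]; subtracting the corresponding multiple of [z X - w] and dividing by [X]
    leaves [P + (c / w) z], a relation of lower degree. *)
Lemma horner_eq0_coef P : (forall i, T P`_i) -> P.[t] = 0 ->
  forall i, nonunits T P`_i.
Proof.
move: {-1}(size P) (leqnn (size P)) => n; elim: n P => [|n IHn] P.
  by rewrite leqn0 size_poly_eq0 => /eqP-> _ _ i; rewrite coef0; exact: nonunits0.
elim/poly_ind: P => [|P c _]; first by move=> _ _ _ i; rewrite coef0; exact: nonunits0.
move=> sP /coef_consP[TP Tc]; rewrite hornerMXaddC => Pt0.
have {}sP : (size P <= n)%N.
  move: sP; rewrite -cons_poly_def size_cons_poly; case: ifP => //.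
  by case/andP=> /nilP P0 _ _; rewrite P0.
have [P0|P0] := eqVneq P 0.
  move: Pt0; rewrite P0 horner0 mul0r add0r => ->.
  by move=> i; rewrite mul0r add0r coef0; exact: nonunits0.
have [k TPk] := horner_clear TP.
have cE : c = - (P.[t] * t) by apply/eqP; rewrite -addr_eq0 addrC Pt0.
have Tcw : T (c / w).
  apply: (@regular_pair_div k.+1) => //.
  have -> : z ^+ k.+1 * c / w = - (z ^+ k * P.[t]).
    by rewrite cE exprS; field; rewrite w0 z0.
  exact: subN.
have Tbz : T (c / w * z) by apply: subM => //; exact: nonunits_sub mz.
have nbz : nonunits T (c / w * z) by apply: nonunits_mul.
have nQ i : nonunits T (P + (c / w * z)%:P)`_i.
  apply: IHn.
  - rewrite (leq_trans (size_polyD _ _)) // geq_max sP size_polyC.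
    by apply: leq_trans (leq_b1 _) (leq_trans _ sP); rewrite lt0n size_poly_eq0.
  - by move=> j; rewrite coefD coefC; apply: subD => //; case: ifP => // _; exact: sub0.
  - rewrite hornerD hornerC.
    have t0 : t != 0 by rewrite mulf_neq0 ?invr_neq0.
    by apply: (mulIf t0); rewrite mulrDl mul0r -[RHS]Pt0; field; rewrite z0 w0.
apply/coef_consP; split=> [i|]; last by rewrite -(divfK w0 c); exact: nonunits_mul.
have := nQ i; rewrite coefD coefC; case: (i == 0)%N; rewrite ?addr0 // => h.
by rewrite -[P`_i](addrK (c / w * z)); exact: nonunits_subr.
Qed.

(** With [horner_nonunits], this identifies the exceptional fibre of the chart, its quotient by [z],
    with the polynomial ring in [w / z] over the residue field of [T]. *)
Lemma horner_multiple_coef P g : (forall i, T P`_i) -> chart T z g ->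
  P.[t] = z * g -> forall i, nonunits T P`_i.
Proof.
move=> TP /chartP[Q TQ ->] PQ i; have Tz := nonunits_sub mz.
have nPQ : nonunits T (P - z *: Q)`_i.
  apply: horner_eq0_coef => [j|]; last by rewrite hornerD hornerN hornerZ PQ subrr.
  by rewrite coefB coefZ; apply: subB => //; exact: subM.
move: nPQ; rewrite coefB coefZ => nPQ; rewrite -[P`_i](subrK (z * Q`_i)).
by apply: nonunits_add => //; rewrite mulrC; exact: nonunits_mul.
Qed.

End Chart.

(** The chart of an element [z = a u + b v] with [a] and [b] nonunits has no exceptional points:
    there [1 = (u / z) a + (v / z) b] would lie in [q]. So one of the coefficients is a unit, and
    [z] can replace the corresponding generator. *)
Lemma near_parameter T z q u v : local_subring T -> nonunits T z -> z != 0 ->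
  prime_ideal (chart T z) q -> q z -> nonunits T = ideal2 T u v ->
  exists w, nonunits T = ideal2 T z w.
Proof.
move=> lT nz z0 qP qz mE; have hT := proj1 lT.
have [nu nv] : nonunits T u /\ nonunits T v by rewrite mE; exact: ideal2_gen.
have new u1 v1 a b : nonunits T u1 -> nonunits T v1 -> T b -> units T a ->
    z = a * u1 + b * v1 -> nonunits T `<=` ideal2 T u1 v1 ->
    nonunits T = ideal2 T z v1.
  move=> nu1 nv1 Tb /unitsP[Ta a0 TVa] zE mE1; apply/seteqP; split=> x.
    move=> /mE1[c Tc [d Td <-]]; exists (c / a); first exact: subM.
    exists (d - c / a * b).
      by apply: subB => //; apply: subM => //; exact: subM.
    by rewrite zE; field.
  by move=> [c Tc [d Td <-]]; apply: nonunits_add => //; exact: nonunits_mul.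
have := nz; rewrite {1}mE => -[a Ta [b Tb zE]].
case: (unit_or_nonunit Ta) => [ua|na].
  by exists v; apply: (new u v a b) => //; rewrite -mE.
case: (unit_or_nonunit Tb) => [ub|nb].
  exists u; apply: (new v u b a) => //; first by rewrite addrC zE.
  by rewrite mE => x [c Tc [d Td <-]]; exists d => //; exists c => //; rewrite addrC.
have [[_ _ qD qM] nq1 _] := qP; exfalso; apply: nq1.
have qn x : nonunits T x -> q x.
  by move=> nx; rewrite -(divfK z0 x); apply: qM => //; exact: chart_div.
have -> : 1 = (u / z) * a + (v / z) * b.
  by apply: (mulIf z0); rewrite mul1r -{1}zE; field.
by apply: qD; apply: qM; [exact: chart_div|exact: qn|exact: chart_div|exact: qn].
Qed.

End RegularPoints.

(** * Closed points of the exceptional divisor *)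

Section ExceptionalPoints.
Variables (K : closedFieldType) (F : fieldType) (kappa : {rmorphism K -> F}).
Variable base : set F.
Hypothesis base_const : forall c, base (kappa c).
Implicit Types (T V W q : set F) (a b g u x y z w : F) (c : K) (P : {poly F}).

Definition regular_point T : Prop :=
  [/\ local_subring T, dominated base T,
      (forall a, T a -> exists c, nonunits T (a - kappa c))
    & exists z w, regular_pair T z w].

Lemma regular_point_const T c : regular_point T -> T (kappa c).
Proof. by case=> _ [sub _] _ _; exact: sub. Qed.

Lemma regular_point_units T c : regular_point T -> c != 0 -> units T (kappa c).
Proof.
move=> rT c0; apply/unitsP; rewrite fmorph_eq0 -fmorphV.
by split=> //; exact: regular_point_const.
Qed.

Section Structure.
Variables (T q : set F) (z w : F).
Hypotheses (rT : regular_point T) (nz : nonunits T z) (z0 : z != 0).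
Hypotheses (qmax : maximal_ideal (chart T z) q) (qz : q z).
Hypothesis mE : nonunits T = ideal2 T z w.
Local Notation t := (w / z).
Local Notation T' := (localize (chart T z) q).

Let lT : local_subring T. Proof. by case: rT. Qed.
Let hT : is_subring T. Proof. by case: lT. Qed.
Let cS : is_subring (chart T z). Proof. exact: chart_subring. Qed.
Let qP : prime_ideal (chart T z) q. Proof. exact: maximal_ideal_prime. Qed.
Let qD x y : q x -> q y -> q (x + y).
Proof. by case: qP => -[_ _ h _] _ _; exact: h. Qed.
Let qM x y : chart T z x -> q y -> q (x * y).
Proof. by case: qP => -[_ _ _ h] _ _; exact: h. Qed.
Let q1 : ~ q 1. Proof. by case: qP. Qed.
Let cT x : T x -> chart T z x. Proof. exact: chart_incl. Qed.
Let ck c : chart T z (kappa c). Proof. exact: cT (regular_point_const c rT). Qed.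
Let ct : chart T z t.
Proof.
by apply: chart_div; rewrite mE; have [_] := ideal2_gen z w hT.
Qed.
Let qB x y : q x -> q y -> q (x - y).
Proof.
move=> qx qy; apply: qD => //; rewrite -mulN1r; apply: qM => //.
by apply: (subN cS) => //; exact: (sub1 cS).
Qed.
Let q_nonunit x : nonunits T x -> q x.
Proof. by move=> nx; rewrite -(divfK z0 x); apply: qM => //; exact: chart_div. Qed.
Let q_const c : q (kappa c) -> c = 0.
Proof.
move=> qc; apply/eqP/negPn/negP => c0; apply: q1.
by rewrite -(mulVf (_ : kappa c != 0)) ?fmorph_eq0 // -fmorphV; exact: qM.
Qed.

Let chart_residue_poly g : chart T z g ->
  exists h : {poly K}, q (g - (map_poly kappa h).[t]).
Proof.
move=> /(chartP lT mE z0)[P TP ->] {g}; elim/poly_ind: P TP => [_|P a IHP].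
  by exists 0; rewrite rmorph0 horner0 subrr; case: qP => -[_ h _ _] _ _.
move=> /coef_consP[/IHP[h qh] Ta]; have [_ _ /(_ a Ta)[c nc] _] := rT.
exists (h * 'X + c%:P); rewrite rmorphD rmorphM /= map_polyX map_polyC /=.
rewrite !hornerMXaddC.
have -> : forall s s' e e' : F, s * t + e - (s' * t + e') = t * (s - s') + (e - e').
  by move=> *; ring.
by apply: qD; [exact: qM | exact: q_nonunit].
Qed.

(* The residue field of a closed point is generated by one element over the
   algebraically closed field [K]. *)
Lemma exceptional_coordinate : exists c, q (t - kappa c).
Proof.
apply: contrapT => nex; have nt c : ~ q (t - kappa c) by move=> qc; apply: nex; exists c.
have [||g cg qg] := maximal_ideal_inv cS qmax (a := t) => //.
  by have := nt 0; rewrite rmorph0 subr0.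
have [h qh] := chart_residue_poly cg.
(* [h(t)] is an inverse of [t] modulo [q], so [p] kills [t] there. It is nonzero, having constant
   term 1, and splits over [K]; as [q] is prime, one of the linear factors must vanish at [t]. *)
pose p := 1 - h * 'X.
have qp : q (map_poly kappa p).[t].
  rewrite rmorphB rmorph1 rmorphM /= map_polyX hornerD hornerN hornerMX hornerC.
  have -> : 1 - (map_poly kappa h).[t] * t
    = (1 - g * t) + t * (g - (map_poly kappa h).[t]) by ring.
  by apply: qD => //; exact: qM.
have p0 : p != 0.
  apply/eqP => /(congr1 (fun p : {poly K} => p`_0)).
  by rewrite coefB coefMX coef1 coef0 subr0 => /eqP; rewrite oner_eq0.
have [s pE] := closed_field_poly_normal p.
move: qp; rewrite pE map_polyZ hornerZ rmorph_prod /= horner_prod.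
set l := lead_coef p; have l0 : l != 0 by rewrite lead_coef_eq0.
have cprod : chart T z (\prod_(i <- s) (map_poly kappa ('X - i%:P)).[t]).
  apply: (@big_ind _ (chart T z)); [exact: (sub1 cS) | exact: (subM cS)|] => i _.
  by rewrite rmorphB /= map_polyX map_polyC hornerXsubC; exact: (subB cS ct (ck _)).
have [_ _ qprime] := qP; move=> /(qprime _ _ (ck l) cprod)[/q_const/eqP|].
  by rewrite (negPf l0).
move: cprod; elim: s {pE} => [|i s IHs]; first by rewrite big_nil.
rewrite big_cons rmorphB /= map_polyX map_polyC hornerXsubC => _.
have cs : chart T z (\prod_(j <- s) (map_poly kappa ('X - j%:P)).[t]).
  apply: (@big_ind _ (chart T z)); [exact: (sub1 cS) | exact: (subM cS)|] => j _.
  by rewrite rmorphB /= map_polyX map_polyC hornerXsubC; exact: (subB cS ct (ck _)).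
by move=> /(qprime _ _ (subB cS ct (ck i)) cs)[/nt|/(IHs cs)].
Qed.

Variable c : K.
Hypothesis qc : q (t - kappa c).

Let chart_residue g : chart T z g -> exists d g1 g2,
  [/\ chart T z g1, chart T z g2 & g = kappa d + z * g1 + (t - kappa c) * g2].
Proof.
move=> /(chartP lT mE z0)[P TP ->] {g}; elim/poly_ind: P TP => [_|P a IHP].
  exists 0, 0, 0; rewrite rmorph0 horner0 !mulr0 !addr0.
  by split=> //; exact: (sub0 cS).
move=> /coef_consP[/IHP[d [g1 [g2 [cg1 cg2 PE]]]] Ta].
have [_ _ /(_ a Ta)[e ne] _] := rT.
exists (d * c + e), (g1 * t + (a - kappa e) / z), (kappa d + g2 * t); split.
- by apply: (subD cS) => //; [exact: (subM cS) | exact: chart_div].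
- by apply: (subD cS) => //; exact: (subM cS).
- by rewrite hornerMXaddC PE rmorphD rmorphM /=; field.
Qed.

Let ideal_q g : chart T z g -> q g -> exists g1 g2,
  [/\ chart T z g1, chart T z g2 & g = z * g1 + (t - kappa c) * g2].
Proof.
move=> cg qg; have [d [g1 [g2 [cg1 cg2 gE]]]] := chart_residue cg.
exists g1, g2; split=> //; rewrite gE (q_const (c := d)) ?rmorph0 ?add0r //.
have -> : kappa d = g - (g1 * z + g2 * (t - kappa c)) by rewrite gE; ring.
by apply: qB => //; apply: qD; exact: qM.
Qed.

Lemma exceptional_nonunits : nonunits T' = ideal2 T' z (t - kappa c).
Proof.
apply/seteqP; split=> x.
  move=> nx; have [[a ca [b [cb nb] xE]] _] := nx.
  move: nx; rewrite -xE => /(localize_nonunit qP ca cb nb)/(ideal_q ca).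
  move=> [g1 [g2 [cg1 cg2 aE]]].
  exists (g1 / b); first exact: localize_in.
  exists (g2 / b); first exact: localize_in.
  by rewrite aE; field; rewrite z0 (notin_prime_neq0 qP nb).
have lT' := localize_local cS qP.
have n1 : nonunits T' z by apply/(localize_nonunit_incl cS qP) => //; apply: cT; case: nz.
have n2 : nonunits T' (t - kappa c).
  by apply/(localize_nonunit_incl cS qP) => //; exact: (subB cS ct (ck c)).
move=> [a Ta [b Tb <-]].
by apply: (nonunits_add lT'); apply: (nonunits_mul (proj1 lT')).
Qed.

Lemma exceptional_residue a : T' a -> exists d, nonunits T' (a - kappa d).
Proof.
move=> [x cx [y [cy ny] <-]].
have [d [g1 [g2 [cg1 cg2 xE]]]] := chart_residue cx.
have [e [h1 [h2 [ch1 ch2 yE]]]] := chart_residue cy.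
have y0 := notin_prime_neq0 qP ny.
have e0 : kappa e != 0.
  rewrite fmorph_eq0; apply/eqP => e0; apply: ny; rewrite yE e0 rmorph0 add0r.
  by rewrite mulrC [X in _ + X]mulrC; apply: qD; exact: qM.
exists (d / e).
have -> : x / y - kappa (d / e) = (x - kappa (d / e) * y) / y.
  by rewrite mulrBl mulfK.
have ckh h : chart T z h -> chart T z (kappa (d / e) * h) by apply: (subM cS).
apply/(localize_nonunit qP) => //; first exact: (subB cS cx (ckh _ cy)).
have -> : x - kappa (d / e) * y =
   (g1 - kappa (d / e) * h1) * z + (g2 - kappa (d / e) * h2) * (t - kappa c).
  by rewrite xE yE rmorphM fmorphV; field; rewrite z0 e0.
by apply: qD; apply: qM => //; [exact: (subB cS cg1 (ckh _ ch1)) |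
                                exact: (subB cS cg2 (ckh _ ch2))].
Qed.

Lemma exceptional_regular_pair : regular_pair T' z (t - kappa c).
Proof.
have [_ _ _ [u [v uv]]] := rT; have syz := regular_pair_change lT uv mE.
have coef_lin (S : set F) : S 1 -> S 0 -> S (- kappa c) ->
    forall i, S ('X - (kappa c)%:P)`_i.
  move=> S1 S0 Sc i; rewrite coefB coefX coefC.
  by case: i => [|[|i]]; rewrite /= ?mulr1n ?mulr0n ?subr0 ?sub0r.
split=> //; first exact: exceptional_nonunits.
  apply/eqP => t0; have lin0 : ('X - (kappa c)%:P).[t] = 0 by rewrite hornerXsubC.
  have Tlin i : T ('X - (kappa c)%:P)`_i.
    by apply: coef_lin; [exact: sub1 | exact: sub0 | apply: subN => //; exact: regular_point_const].
  have := horner_eq0_coef lT mE z0 syz Tlin lin0 1%N.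
  by rewrite coefB coefX coefC subr0 => /(nonunits1 hT).
move=> _ _ [a1 ca1 [a2 [ca2 na2] <-]] [b1 cb1 [b2 [cb2 nb2] <-]] ab.
have a20 := notin_prime_neq0 qP na2; have b20 := notin_prime_neq0 qP nb2.
have [P TP PE] := chartP lT mE z0 (subM cS cb1 ca2).
have TP' i : T (P * ('X - (kappa c)%:P))`_i.
  rewrite mulrBr mulrC [P * _]mulrC mul_polyC coefB coefZ coefXM.
  have Tk := regular_point_const c rT.
  by apply: subB => //; [case: ifP => // _; exact: sub0 | exact: subM].
have nP i : nonunits T (P * ('X - (kappa c)%:P))`_i.
  apply: (horner_multiple_coef lT mE z0 syz TP' (g := a1 * b2)); first exact: (subM cS).
  rewrite hornerM hornerXsubC -PE.
  have := congr1 (fun x => x * (a2 * b2)) ab => /=.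
  have -> : a1 / a2 * z * (a2 * b2) = z * (a1 * b2) by field.
  by move->; field; rewrite z0 b20.
(* [X - kappa c] is monic, so the coefficients of [P] are recovered from those of the product by
   descending induction from the degree. *)
have nP2 i : nonunits T P`_i.
  suff: forall n i, (size P <= i + n)%N -> nonunits T P`_i.
    by move=> /(_ (size P) i); apply; rewrite leq_addl.
  elim=> [|n IHn] {}i si; first by rewrite addn0 in si; rewrite nth_default //; exact: nonunits0.
  have := nP i.+1; rewrite mulrBr coefB coefMX /= coefMC => n1.
  rewrite -[P`_i](subrK (P`_i.+1 * kappa c)); apply: nonunits_add => //.
  rewrite mulrC; apply: nonunits_mul => //; first exact: regular_point_const.
  by apply: IHn; rewrite addSnnS.
have [g cg gE] := horner_nonunits lT mE z0 nP2.
have -> : b1 / b2 / z = g / (b2 * a2).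
  have -> : b1 = z * g / a2 by rewrite -gE -PE mulfK.
  by field; rewrite z0 a20 b20.
apply: localize_in cg (subM cS cb2 ca2) _.
exact: (notin_prime_mul qP cb2 ca2 nb2 na2).
Qed.

End Structure.

Lemma exceptional_pointP T T' : regular_point T -> exceptional_point T T' ->
  exists z, [/\ nonunits T z /\ z != 0, chart T z `<=` T',
    (exists w, nonunits T = ideal2 T z w),
    (forall g, T' g -> exists a b, [/\ chart T z a, chart T z b, units T' b & g = a / b])
    & forall w, nonunits T = ideal2 T z w ->
        exists c, regular_pair T' z (w / z - kappa c)].
Proof.
move=> rT [z [q [nz z0 qmax qz ->]]]; have cS := chart_subring T z.
have qP := maximal_ideal_prime cS qmax.
have [lT _ _ [u [v [mE _ _ _]]]] := rT.
exists z; split=> //; first exact: localize_incl.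
- exact: near_parameter lT nz z0 qP qz mE.
- move=> _ [a ca [b [cb nb] <-]]; exists a, b; split=> //.
  exact: localize_unit.
move=> w mE'; have [c qc] := exceptional_coordinate rT z0 qmax qz mE'.
by exists c; exact: exceptional_regular_pair.
Qed.

Lemma regular_exceptional_point T T' : regular_point T ->
  exceptional_point T T' -> regular_point T'.
Proof.
move=> rT TT'; have near := exceptional_point_near TT'.
have [lT bT _ [u [v [uv _ _ _]]]] := rT.
split; [exact: near_local near | exact: dominated_trans bT (near_dominated near)| |].
  case: TT' => z [q [nz z0 qmax qz ->]].
  have qP := maximal_ideal_prime (chart_subring T z) qmax.
  have [w mE] := near_parameter lT nz z0 qP qz uv.
  have [c qc] := exceptional_coordinate rT z0 qmax qz mE.
  exact: exceptional_residue qc.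
have [z [_ _ [w mE] _ /(_ w mE)[c reg]]] := exceptional_pointP rT TT'.
by exists z, (w / z - kappa c).
Qed.

(** This distinguishes components from closed points: [w / z] has a nonconstant residue along the
    exceptional divisor, since [X - kappa c] has the unit coefficient 1 and so its value at [w / z]
    is not a multiple of [z]. *)
Lemma generic_point_residue T W : regular_point T ->
  exceptional_generic_point T W ->
  exists2 s, W s & forall c, ~ nonunits W (s - kappa c).
Proof.
move=> rT [z [nz z0 qP ->]]; have cS := chart_subring T z.
have [lT _ _ [u [v uv]]] := rT; have hT := proj1 lT.
have qz : ideal1 (chart T z) z z by exists 1; [exact: (sub1 cS) | rewrite mul1r].
have [w mE] : exists w, nonunits T = ideal2 T z w.
  by case: uv => mE _ _ _; exact: near_parameter lT nz z0 qP qz mE.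
have syz := regular_pair_change lT uv mE.
have ct : chart T z (w / z) by apply: chart_div; rewrite mE; have [] := ideal2_gen z w hT.
exists (w / z); first exact: localize_incl.
move=> c /(localize_nonunit_incl cS qP)[|g cg gE].
  by apply: (subB cS) => //; apply: chart_incl; exact: regular_point_const.
have Tlin i : T ('X - (kappa c)%:P)`_i.
  rewrite coefB coefX coefC; case: i => [|[|i]]; rewrite /= ?mulr1n ?mulr0n ?subr0 ?sub0r.
  - by apply: subN => //; exact: regular_point_const.
  - exact: sub1.
  - exact: sub0.
have := horner_multiple_coef lT mE z0 syz Tlin cg _ 1%N.
rewrite coefB coefX coefC subr0 hornerXsubC -gE mulrC => /(_ erefl).
exact: nonunits1.
Qed.

End ExceptionalPoints.

(** * Separatedness of iterated blow-ups *)

Section SeparatedModels.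
Variables (K : closedFieldType) (F : fieldType) (kappa : {rmorphism K -> F}).
Variable base : set F.
Hypothesis base_const : forall c, base (kappa c).
Implicit Types (T V W Z : set F).
Local Notation regular_point := (regular_point kappa base).

(** An invariant of blow-ups. Its last clause is what later prevents both parameters at a closed
    point from vanishing on a component through that point. *)
Definition separated_model (Y : model F) : Prop :=
  [/\ (forall T, closed_points Y T -> regular_point T),
      (forall W, exc_components Y W -> local_subring W /\ dominated base W),
      (forall T T' V, closed_points Y T -> closed_points Y T' ->
         is_subring V -> dominated T V -> dominated T' V -> T = T')
    & (forall T W, closed_points Y T -> exc_components Y W -> ~ dominated T W)].

Lemma separated_model_base :
  regular_point base -> separated_model (Model [set base] set0).
Proof. by move=> rb; split=> [T ->|W|T T' V -> ->|T W _]. Qed.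

Lemma separated_model_blowup Y (Z : set (set F)) : separated_model Y ->
  Z `<=` closed_points Y -> separated_model (blowup Y Z).
Proof.
move=> [reg comp sepP sepW] ZY.
have near T0 T : Z T0 -> exceptional_point T0 T ->
    closed_points Y T0 /\ dominated T0 T.
  by move=> /ZY YT0 /exceptional_point_near/near_dominated.
have nearW T0 W : Z T0 -> exceptional_generic_point T0 W ->
    [/\ closed_points Y T0, dominated T0 W & is_subring W].
  move=> /ZY YT0 /exceptional_generic_near h.
  by split=> //; [exact: near_dominated | exact: (proj1 (near_local h))].
split.
- move=> T [[YT _]|[T0 /ZY YT0 T0T]]; first exact: reg.
  exact: regular_exceptional_point (reg _ YT0) T0T.
- move=> W [YW|[T0 /ZY YT0 /exceptional_generic_near T0W]]; first exact: comp.
  split; first exact: near_local T0W.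
  by have [_ bT _ _] := reg _ YT0; exact: dominated_trans (near_dominated T0W).
- have half T T0 T' V : (closed_points Y `\` Z) T -> Z T0 ->
      exceptional_point T0 T' -> is_subring V -> dominated T V ->
      dominated T' V -> False.
    move=> [YT nZT] ZT0 T0T' hV TV T'V; have [YT0 dT0] := near _ _ ZT0 T0T'.
    apply: nZT; rewrite (sepP T T0 V) //.
    exact: dominated_trans T'V.
  move=> T T' V [YT|[T0 ZT0 T0T]] [YT'|[T0' ZT0' T0T']] hV TV T'V.
  + by case: YT => YT _; case: YT' => YT' _; exact: (sepP T T' V).
  + by case: (half T T0' T' V).
  + by case: (half T' T0 T V).
  + have [YT0 d0] := near _ _ ZT0 T0T; have [YT0' d0'] := near _ _ ZT0' T0T'.
    have e : T0 = T0'.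
      by apply: (sepP _ _ V) => //; [exact: dominated_trans TV | exact: dominated_trans T'V].
    apply: near_unique hV _ _ TV T'V; first exact: exceptional_point_near T0T.
    by rewrite e; exact: exceptional_point_near T0T'.
- move=> T W [[YT nZT]|[T0 ZT0 T0T]] [YW|[T1 ZT1 T1W]] TW.
  + exact: sepW TW.
  + have [YT1 d1 hW] := nearW _ _ ZT1 T1W.
    by apply: nZT; rewrite (sepP T T1 W).
  + have [YT0 d0] := near _ _ ZT0 T0T.
    by apply: (sepW T0 W) => //; exact: dominated_trans TW.
  + have [YT1 d1 hW] := nearW _ _ ZT1 T1W; have [YT0 d0] := near _ _ ZT0 T0T.
    (* The closed point and the component are both new. They then lie over the same blown-up point,
       and uniqueness makes them equal, although one has only constant residues and the other does
       not. *)
    have e : T0 = T1 by apply: (sepP _ _ W) => //; exact: dominated_trans TW.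
    rewrite -e in T1W.
    have TE : T = W.
      apply: near_unique hW _ _ TW _; [exact: exceptional_point_near T0T | |by split].
      exact: exceptional_generic_near T1W.
    have [s Ws sW] := generic_point_residue base_const (reg _ YT0) T1W.
    have [_ _ res _] := regular_exceptional_point base_const (reg _ YT0) T0T.
    by rewrite TE in res; have [c /sW] := res _ Ws.
Qed.

End SeparatedModels.

(** * The base ring is a regular point *)

Section BaseRing.
Variables (K : closedFieldType) (R : idomainType) (iota : {rmorphism K -> R}).
Hypotheses (hR : complete_regular_local2 R) (hK : coefficient_field iota).
Local Notation F := {fraction R}.
Local Notation toF := (@tofrac R).
Local Notation m := (@nonunits R setT).

Definition const_frac : {rmorphism K -> F} := toF \o iota.

Lemma base_ring_subring : is_subring (@base_ring R).
Proof.
split; first by exists 1; rewrite ?rmorph1.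
- by move=> _ _ [x _ <-] [y _ <-]; exists (x - y); rewrite ?rmorphB.
- by move=> _ _ [x _ <-] [y _ <-]; exists (x * y); rewrite ?rmorphM.
Qed.

Lemma base_ring_nonunit a : nonunits (@base_ring R) (toF a) <-> m a.
Proof.
split=> [[_ nu]|[_ nu]]; split=> //.
- move=> [_ [b _ ab]]; apply: nu; split; first by exists a.
  by exists (toF b); [exists b | rewrite -rmorphM ab rmorph1].
- by exists a.
- move=> [_ [_ [b _ <-] ab]]; apply: nu; split=> //; exists b => //.
  by apply/eqP; rewrite -tofrac_eq rmorphM ab rmorph1.
Qed.

Lemma base_ring_regular : regular_point const_frac (@base_ring R) (@base_ring R).
Proof.
have [m_ideal _ _ [x [y mE]] _] := hR.
have mE' : m = ideal2 setT y x by rewrite ideal2C.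
split=> //.
- split=> [|u v]; first exact: base_ring_subring.
  move=> nu nv; have [[a _ aE] _] := nu; have [[b _ bE] _] := nv.
  move: nu nv; rewrite -aE -bE -rmorphD => /base_ring_nonunit ma /base_ring_nonunit mb.
  by apply/base_ring_nonunit; case: m_ideal => _ _ h _; exact: h.
- by split.
- move=> _ [a _ <-]; have [c mc] := hK a; exists c.
  by rewrite /= -rmorphB; apply/base_ring_nonunit.
- exists (toF x), (toF y); split.
  + apply/seteqP; split=> [u nu|_ [_ [a _ <-] [_ [b _ <-] <-]]].
      have [[a _ aE] _] := nu; move: nu; rewrite -aE => /base_ring_nonunit.
      rewrite mE => -[b _ [c _ <-]]; exists (toF b); first by exists b.
      by exists (toF c); [exists c | rewrite rmorphD !rmorphM].
    by rewrite -!rmorphM -rmorphD; apply/base_ring_nonunit; rewrite mE; exists a => //; exists b.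
  + apply/eqP => /eqP; rewrite tofrac_eq0 => /eqP x0.
    by apply: (parameter_power_neq hR mE' (n := 1) (c := 0)); rewrite mul0r expr1.
  + apply/eqP => /eqP; rewrite tofrac_eq0 => /eqP y0.
    by apply: (parameter_power_neq hR mE (n := 1) (c := 0)); rewrite mul0r expr1.
  + move=> _ _ [a _ <-] [b _ <-]; rewrite -!rmorphM => /eqP; rewrite tofrac_eq => /eqP ab.
    have [c ->] := regular_syzygy hR mE ab; exists c => //.
    rewrite rmorphM /= mulfK // tofrac_eq0; apply/eqP => x0.
    by apply: (parameter_power_neq hR mE' (n := 1) (c := 0)); rewrite mul0r expr1.
Qed.

Lemma modification_separated (X : model F) :
  modification X -> separated_model const_frac (@base_ring R) X.
Proof.
have bc c : @base_ring R (const_frac c) by exists (iota c).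
elim=> [|Y T _ sY YT]; apply: separated_model_blowup => //.
- exact/separated_model_base/base_ring_regular.
- by move=> _ ->.
Qed.

Lemma iterated_blowup_separated (X : model F) r (f : 'I_r -> R) k :
  modification X ->
  separated_model const_frac (@base_ring R) (iterated_blowup f X k).
Proof.
have bc c : @base_ring R (const_frac c) by exists (iota c).
move=> /modification_separated sX; elim: k => [//|k IHk].
by apply: separated_model_blowup => // T [].
Qed.

End BaseRing.

(** * Discrete valuation rings *)

Section DiscreteValuationRings.
Variable F : fieldType.
Implicit Types (D : set F) (t u x y : F).

Lemma units_expz D u (n : int) : is_subring D -> units D u -> units D (u ^ n).
Proof.
move=> hD uu; have uX k : units D (u ^+ k).
  by elim: k => [|k IHk]; [exact: units_one | rewrite exprS; exact: units_mul].
by case: n => n; [exact: uX | rewrite NegzE -exprnN; apply: units_inv; exact: uX].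
Qed.

Definition uniformizer D t : Prop :=
  [/\ local_subring D, nonunits D = ideal1 D t & t != 0].

Section Uniformizer.
Variables (D : set F) (t : F).
Hypothesis tP : uniformizer D t.

Let lD : local_subring D. Proof. by case: tP. Qed.
Let hD : is_subring D. Proof. by case: lD. Qed.
Let t0 : t != 0. Proof. by case: tP. Qed.

Lemma uniformizer_nonunit : nonunits D t.
Proof. by case: tP => _ -> _; exists 1; [exact: sub1 | rewrite mul1r]. Qed.

Lemma uniformizer_div x : nonunits D x -> D (x / t).
Proof. by case: tP => _ -> _ -[a Da <-]; rewrite mulfK. Qed.

Lemma uniformizer_expz_unit (n : int) : units D (t ^ n) -> n = 0.
Proof.
have nX k : ~ units D (t ^+ k.+1).
  by move/nonunit_unit; apply; apply: nonunits_exp => //; exact: uniformizer_nonunit.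
case: n => [[//|n]|n] u; first by case: (nX n).
by case: (nX n); move/units_inv: u; rewrite NegzE -exprnN invrK.
Qed.

(** Two generators of the maximal ideal differ by a unit, so the exponent does not depend on the
    uniformizer picked inside [ordv]. *)
Lemma ordvE x (n : int) u : units D u -> x = t ^ n * u -> ordv D x = n%:E.
Proof.
move=> uu xE; have [_ u0 _] := (unitsP D u).1 uu.
have x0 : x != 0 by rewrite xE mulf_neq0 ?expfz_neq0.
rewrite /ordv (negPf x0); congr (_%:E)%E; apply: xget_unique.
  by exists t, u; split=> //; case: tP.
move=> n' [t' [u' [mE' uu' xE']]]; have [_ u'0 _] := (unitsP D u').1 uu'.
have nt' : nonunits D t' by rewrite mE'; exists 1; [exact: sub1 | rewrite mul1r].
have [a Da aE] : ideal1 D t' t by rewrite -mE'; exact: uniformizer_nonunit.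
have Dt' := uniformizer_div nt'.
have ua : units D a.
  have a0 : a != 0 by apply: contra_neq t0 => a0; rewrite -aE a0 mul0r.
  have t'0 : t' != 0 by apply: contra_neq t0 => t'0; rewrite -aE t'0 mulr0.
  apply/unitsP; split=> //.
  by move: Dt'; rewrite -aE invfM mulrCA divff // mulr1.
apply/eqP; rewrite -subr_eq0; apply/eqP/uniformizer_expz_unit.
have a0 : a != 0 by have /unitsP[] := ua.
have t'0 : t' != 0 by apply: contra_neq t0 => t'0; rewrite -aE t'0 mulr0.
have -> : t ^ (n' - n) = a ^ n' * u / u'.
  rewrite expfzDr // -invr_expz.
  have : t ^ n * u = t' ^ n' * u' by rewrite -xE -xE'.
  move/(canRL (mulfK u0)) => ->; rewrite -{1}aE expfzMl; field.
  by rewrite u0 u'0 expfz_neq0.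
apply: units_mul => //; last exact: units_inv.
by apply: units_mul => //; exact: units_expz.
Qed.

(** Together with [uniformizer], this says that [D] is a discrete valuation ring with fraction field
    [F]; a principal maximal ideal alone would allow nonzero elements divisible by every power of
    [t]. *)
Definition uniformizer_spans : Prop :=
  forall x, x != 0 -> exists (n : int) u, units D u /\ x = t ^ n * u.

Lemma uniformizer_mem (n : int) u : units D u -> D (t ^ n * u) <-> 0 <= n.
Proof.
move=> uu; have Du : D u by case: uu.
case: n => n; split=> // h.
  by apply: subM => //; apply: subX => //; exact: nonunits_sub uniformizer_nonunit.
exfalso; have : units D (t ^ Negz n); last by move/uniformizer_expz_unit.
have [_ u0 Du'] := (unitsP D u).1 uu.
have DtN : D (t ^ Negz n) by rewrite -(mulfK u0 (t ^ _)); exact: subM.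
apply/unitsP; split=> //; first by rewrite expfz_neq0.
rewrite NegzE -exprnN invrK; apply: subX => //.
exact: nonunits_sub uniformizer_nonunit.
Qed.

Lemma ordv_ge x (n : int) : uniformizer_spans ->
  (n%:E <= ordv D x)%E <-> D (x * t ^ (- n)).
Proof.
move=> span; have [->|x0] := eqVneq x 0.
  by rewrite mul0r /ordv eqxx leey; split=> // _; exact: sub0.
have [j [u [uu xE]]] := span _ x0; rewrite (ordvE uu xE) lee_fin.
have -> : x * t ^ (- n) = t ^ (j - n) * u by rewrite xE expfzDr // mulrAC.
rewrite -subr_ge0; split=> h; exact/(uniformizer_mem (j - n) uu).
Qed.

(** If [x] is not in [D], its inverse is a nonunit, and the monic equation divided by its leading
    power of [x] writes 1 as a sum of nonunits. *)
Lemma uniformizer_integrally_closed (p : {poly F}) x : uniformizer_spans ->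
  p \is monic -> (forall i, D p`_i) -> root p x -> D x.
Proof.
move=> span p1 Dp px; have [->|x0] := eqVneq x 0; first exact: sub0.
have [j [u [uu xE]]] := span _ x0.
case: (leP 0 j) => [j0|j_lt0]; first by rewrite xE; apply/(uniformizer_mem j uu).
have nxV : nonunits D x^-1.
  have [_ u0 _] := (unitsP D u).1 uu; have uV := units_inv uu.
  rewrite xE invfM invr_expz; split; first by apply/uniformizer_mem => //; lia.
  move=> uxV; have := units_mul hD uxV uu; rewrite divfK //.
  by move/uniformizer_expz_unit; lia.
exfalso; apply: (nonunits1 hD); have DxV := nonunits_sub nxV.
have p0 := monic_neq0 p1; have sp : (size p).-1.+1 = size p by rewrite prednK // size_poly_gt0.
move/eqP: px; rewrite horner_coef -sp big_ord_recr /=.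
have -> : p`_(size p).-1 = 1 by exact/eqP.
rewrite mul1r => /(congr1 (fun v => v * x^-1 ^+ (size p).-1)).
rewrite mul0r mulrDl -exprMn mulfV // expr1n addrC => /eqP.
rewrite addr_eq0 => /eqP ->; rewrite -mulNr; rewrite -sumrN mulr_suml.
apply: (@big_ind _ (nonunits D)); first exact: nonunits0.
  by move=> *; exact: nonunits_add.
move=> i _; rewrite mulNr; apply: nonunits_opp => //.
have qE : (size p).-1 = (i + ((size p).-1 - i).-1.+1)%N.
  by rewrite prednK ?subn_gt0 // subnKC // ltnW.
rewrite [X in x^-1 ^+ X]qE.
rewrite exprD mulrA -[_ * x ^+ i * _]mulrA -exprMn mulfV // expr1n mulr1.
by apply: nonunits_mul => //; exact: nonunits_exp.
Qed.

End Uniformizer.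

Lemma uniformizer_divisor D t x y n : uniformizer D t -> D x -> D y ->
  (exists2 u, units D u & x * y = t ^+ n * u) ->
  exists (j : int) u, units D u /\ x = t ^ j * u.
Proof.
move=> tP Dx Dy [u uu]; have [lD mE t0] := tP; have hD := proj1 lD.
elim: n x Dx => [|n IHn] x Dx xy; case: (unit_or_nonunit Dx) => [ux|nx].
- by exists 0, x; rewrite mul1r.
- case: (nonunit_unit uu); rewrite mul1r in xy; rewrite -xy mulrC.
  exact: nonunits_mul.
- by exists 0, x; rewrite mul1r.
have Dxt := uniformizer_div tP nx.
have [|j [v [uv xE]]] := IHn _ Dxt.
  by rewrite mulrAC xy exprS; field.
exists (j + 1), v; split=> //; rewrite expfzDr // mulrAC -xE expr1z.
by rewrite divfK.
Qed.

End DiscreteValuationRings.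

(** * The normalization of a branch *)

Lemma linear_dependence (K : fieldType) (I J : finType) (M : I -> J -> K) :
  (#|J| < #|I|)%N ->
  exists2 v : I -> K, exists i, v i != 0 & forall j, \sum_i v i * M i j = 0.
Proof.
move=> JI; pose A := \matrix_(a < #|I|, b < #|J|) M (enum_val a) (enum_val b).
have : kermx A != 0.
  rewrite kermx_eq0 -row_leq_rank -ltnNge.
  exact: leq_ltn_trans (rank_leq_col A) JI.
case/rowV0Pn=> u /sub_kermxP uA /eqP u0.
exists (fun i => u 0 (enum_rank i)).
  apply: contrapT => nex; apply: u0; apply/rowP => a; rewrite mxE.
  by apply/eqP/negPn/negP => ua; apply: nex; exists (enum_val a); rewrite enum_valK.
move=> j; have /rowP/(_ (enum_rank j)) := uA; rewrite !mxE => h; rewrite -[RHS]h.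
rewrite (reindex (@enum_val I predT)); last first.
  exact: (onW_bij _ (enum_val_bij I)).
by apply: eq_bigr => a _; rewrite mxE enum_valK enum_rankK.
Qed.

Lemma iterated_expansion (A : comNzRingType) (S : Type) (p : A)
    (val rem : S -> A) (next : S -> S) s N :
  (forall s, val s = rem s + p * val (next s)) ->
  val s = \sum_(i < N) p ^+ i * rem (iter i next s) + p ^+ N * val (iter N next s).
Proof.
move=> step; elim: N => [|N IHN]; first by rewrite big_ord0 add0r mul1r.
by rewrite big_ord_recr /= IHN step exprSr; ring.
Qed.

Section Branch.
Variables (K : closedFieldType) (R : idomainType) (iota : {rmorphism K -> R}).
Hypotheses (hR : complete_regular_local2 R).
Local Notation m := (@nonunits R setT).
Variables (f : R) (L : fieldType) (theta : {rmorphism R -> L}).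
Hypothesis f_irr : irreducible_elt f.
Hypothesis theta_ker : forall g, theta g = 0 <-> multiples f g.
Hypothesis theta_frac : forall l, exists a b, theta b != 0 /\ l = theta a / theta b.
Local Notation kappa := (theta \o iota).

Let m_ideal : is_ideal setT m. Proof. by case: hR. Qed.

Lemma theta_ker_prime : prime_ideal setT [set g | theta g = 0].
Proof.
split=> [|/eqP|a b _ _ /eqP].
- split=> //= [|a b a0 b0|a b _ b0]; first by rewrite rmorph0.
    by rewrite rmorphD a0 b0 addr0.
  by rewrite rmorphM b0 mulr0.
- by rewrite /= rmorph1 oner_eq0.
- by rewrite rmorphM mulf_eq0 => /orP[]/eqP; [left|right].
Qed.

(* The image of [x] is a parameter of the one-dimensional ring [R / f]. *)
Lemma branch_parameter : exists x y n c,
  [/\ m = ideal2 setT x y, theta x != 0, theta y ^+ n = theta c * theta x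
    & forall b, theta b != 0 -> exists e a, theta x ^+ e = theta a * theta b].
Proof.
have [x [y [n [c [d [mE yn]]]]]] := weierstrass_coordinates hR f_irr.
have f0 : theta f = 0 by apply/theta_ker; exists 1; rewrite ?mul1r.
have thyn : theta y ^+ n = theta d * theta x.
  by rewrite -rmorphXn yn rmorphD !rmorphM /= f0 mulr0 add0r.
have fm : m f by apply/nonunitsTP; case: f_irr.
exists x, y, n, d; split=> //.
(* If [x] vanished on the branch, so would [y]. From [x = a f] and [y = b f] one gets [b x = a y],
   hence [a = e x] and [e f = 1], although [f] is not a unit. *)
- apply/eqP => x0; have [_ _ prime_ker] := theta_ker_prime.
  have y0 : theta y = 0.
    apply: (prime_ideal_exp theta_ker_prime (n := n)).
    by rewrite /= rmorphXn /= thyn x0 mulr0.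
  have /theta_ker[a _ aE] := x0; have /theta_ker[b _ bE] := y0.
  have [|e aE'] := regular_syzygy hR mE (a := b) (b := a).
    by rewrite -aE -bE; ring.
  have x_neq0 : x != 0.
    apply/eqP => x_eq0; apply: (@parameter_power_neq R hR y x 1 0).
      by rewrite mE ideal2C.
    by rewrite x_eq0 mul0r.
  have /nonunitsTP/negP := fm; apply; apply/unitrPr; exists e.
  by apply: (mulIf x_neq0); rewrite mul1r -{2}aE aE'; ring.
- move=> b /eqP b0; have [_ noeth _ _ _] := hR.
  have [|j [a]] := krull_height1 m_ideal mE (n := n) (c := d) noeth theta_ker_prime _ b0.
    by rewrite /= rmorphB rmorphXn rmorphM /= thyn subrr.
  rewrite /= rmorphB rmorphXn rmorphM /= => /eqP; rewrite subr_eq0 => /eqP.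
  by exists j, a.
Qed.

Lemma coordinate_expansion x y k g : coefficient_field iota ->
  m = ideal2 setT x y ->
  exists (c : 'I_k -> K) (a b : R),
    g = \sum_j iota (c j) * y ^+ j + x * a + y ^+ k * b.
Proof.
move=> hK mE; elim: k => [|k [c [a [b ->]]]].
  by exists (fun=> 0), 0, g; rewrite big_ord0 mulr0 !add0r mul1r.
have [d] := hK b; rewrite mE => -[u _ [v _ /eqP]]; rewrite eq_sym subr_eq => /eqP bE.
(* The family [c] extended by the last coefficient [d]. *)
exists (fun j => oapp c d (insub (val j))), (a + y ^+ k * u), v.
rewrite big_ord_recr /= insubF ?ltnn //= bE.
have -> : \sum_(i < k) iota (oapp c d (insub (val i))) * y ^+ i
        = \sum_(i < k) iota (c i) * y ^+ i.
  by apply: eq_bigr => i _; rewrite valK.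
by rewrite exprS; ring.
Qed.

Section Normalization.
Variables (D : set L) (t : L).
Hypothesis lD : local_subring D.
Hypothesis thetaD : forall a, D (theta a).
Hypothesis theta_m : forall a, m a -> nonunits D (theta a).
Hypothesis resD : forall d, D d -> exists c, nonunits D (d - kappa c).
Hypothesis mD : nonunits D = ideal1 D t.
Hypothesis hK : coefficient_field iota.

Let hD : is_subring D := proj1 lD.

Let Dt : nonunits D t.
Proof. by rewrite mD; exists 1; [exact: sub1 | rewrite mul1r]. Qed.

Let kappa_nonunit c : nonunits D (kappa c) -> c = 0.
Proof.
move=> [_ nu]; apply/eqP/negPn/negP => c0; apply: nu; apply/unitsP.
by split; rewrite ?fmorph_eq0 -?fmorphV //=; exact: thetaD.
Qed.

Lemma branch_uniformizer : uniformizer D t.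
Proof.
split=> //; have [x [y [n [c [mE x0 _ _]]]]] := branch_parameter.
have mx : m x by rewrite mE; exact: ideal2_genl.
have := theta_m mx; rewrite mD => -[a _ aE].
by apply: contra_neq x0 => t0; rewrite -aE t0 mulr0.
Qed.

Let t0 : t != 0. Proof. by have [] := branch_uniformizer. Qed.

Lemma residue_expansion_unique k (c : 'I_k -> K) :
  (forall s, D ((\sum_(j < k) kappa (c j) * t ^+ j) / t ^+ s)) -> forall j, c j = 0.
Proof.
elim: k c => [|k IHk] c hc; first by case.
have sumE : \sum_j kappa (c j) * t ^+ j
    = kappa (c ord0) + t * \sum_j kappa (c (lift ord0 j)) * t ^+ j.
  rewrite big_ord_recl expr0 mulr1; congr (_ + _); rewrite mulr_sumr.
  by apply: eq_bigr => j _; rewrite lift0 exprS mulrCA.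
have Dsum : D (\sum_j kappa (c (lift ord0 j)) * t ^+ j).
  apply: (sub_sum hD) => j; apply: subM => //; first exact: thetaD.
  by apply: subX => //; exact: nonunits_sub Dt.
have c0 : c ord0 = 0.
  apply: kappa_nonunit.
  have -> : kappa (c ord0) = (\sum_j kappa (c j) * t ^+ j) / t ^+ 1 * t
      - (\sum_j kappa (c (lift ord0 j)) * t ^+ j) * t.
    by rewrite sumE expr1 divfK //; ring.
  by apply: nonunits_subr => //; apply: nonunits_mul.
move: sumE; rewrite c0 rmorph0 add0r => sumE.
have {}IHk := IHk (fun j => c (lift ord0 j)).
move=> j; case: (unliftP ord0 j) => [i ->|->] //; apply: IHk => s.
by have := hc s.+1; rewrite sumE exprS invfM mulrACA mulfV // mul1r.
Qed.

Section Separation.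
Variables (p : L) (k : nat).
Hypothesis Dp : nonunits D p.
Hypothesis p0 : p != 0.
Hypothesis p_inf : forall s, D (p / t ^+ s).

(** The coefficient of [p ^ 0] is a polynomial in [t] divisible by [p], hence by all powers of [t],
    and is therefore zero; then one factor [p] cancels. So the [p ^ i * t ^ j] are independent over
    [K] modulo [p ^ n]. *)
Lemma double_expansion_unique n (v : 'I_n -> 'I_k -> K) d : D d ->
  \sum_(i < n) p ^+ i * (\sum_(j < k) kappa (v i j) * t ^+ j) = p ^+ n * d ->
  forall i j, v i j = 0.
Proof.
move=> Dd; elim: n v => [|n IHn] v; first by move=> _ [].
have Dq i : D (\sum_(j < k) kappa (v i j) * t ^+ j).
  apply: (sub_sum hD) => j; apply: subM => //; first exact: thetaD.
  by apply: subX => //; exact: nonunits_sub Dt.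
rewrite big_ord_recl mul1r => e.
set s := \sum_(i < n) p ^+ i * (\sum_(j < k) kappa (v (lift ord0 i) j) * t ^+ j).
have Ds : D s.
  apply: (sub_sum hD) => i; apply: subM => //.
  by apply: subX => //; exact: nonunits_sub Dp.
have sE : \sum_(i < n) p ^+ lift ord0 i * (\sum_(j < k) kappa (v (lift ord0 i) j) * t ^+ j)
    = p * s.
  by rewrite mulr_sumr; apply: eq_bigr => i _; rewrite lift0 exprS mulrA.
rewrite sE in e.
have v0 j : v ord0 j = 0.
  apply: (residue_expansion_unique (c := v ord0)) => l.
  have -> : \sum_(j < k) kappa (v ord0 j) * t ^+ j = p * (p ^+ n * d - s).
    by rewrite mulrBr mulrA -exprS -e addrK.
  rewrite mulrAC; apply: subM => //; apply: subB => //; apply: subM => //.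
  by apply: subX => //; exact: nonunits_sub Dp.
move=> i j; case: (unliftP ord0 i) => [{}i ->|->] //.
apply: (IHn (fun i => v (lift ord0 i))); apply: (mulfI p0); rewrite -/s.
move: e; rewrite exprS -mulrA => <-.
by rewrite big1 ?add0r // => l _; rewrite v0 rmorph0 mul0r.
Qed.

End Separation.

(* If [theta x] were divisible by all powers of [t], the products of the powers
   of [x] and of [t] (brought into [R / f] by a power of [x]) would be too many
   independent elements modulo a power of [x]. *)
Lemma branch_parameter_order x y n c : m = ideal2 setT x y -> theta x != 0 ->
  theta y ^+ n = theta c * theta x ->
  (forall b, theta b != 0 -> exists e a, theta x ^+ e = theta a * theta b) ->
  ~ forall s, D (theta x / t ^+ s).
Proof.
move=> mE x0 yn xpow p_inf; pose p := theta x.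
have mx : m x by rewrite mE; exact: ideal2_genl.
have [e [a1 tE]] : exists e a1, t * p ^+ e = theta a1.
  have [a [b [b0 tE]]] := theta_frac t; have [e [a' xe]] := xpow _ b0.
  by exists e, (a * a'); rewrite tE /p xe rmorphM; field.
(* Since [y ^ n] is a multiple of [x] on the branch, the powers [y ^ j] with [j < n] span [R / f]
   modulo [x]; iterating [N] times bounds the dimension modulo [x ^ N] by [N * n]. *)
have step g : exists cg : ('I_n -> K) * R,
    theta g = \sum_j kappa (cg.1 j) * theta y ^+ j + p * theta cg.2.
  have [d [a [b ->]]] := coordinate_expansion n g hK mE.
  exists (d, a + c * b) => /=; rewrite !rmorphD !rmorphM rmorphXn /= yn rmorph_sum /=.
  rewrite /p; have -> : \sum_i theta (iota (d i) * y ^+ i) = \sum_j theta (iota (d j)) * theta y ^+ j.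
    by apply: eq_bigr => i _; rewrite rmorphM rmorphXn.
  by ring.
have /choice[h hP] := step.
pose nx g := (h g).2.
(* There are [N' * n.+1] products [p ^ i * t ^ j], brought into [R / f] by the factor [p ^ (e * n)],
   against [N * n] coefficients. They outnumber these because [N' > n * (e * n)]. Cancelling
   [p ^ (e * n)] leaves a relation modulo [p ^ N']. *)
pose N' := (n * (e * n)).+1; pose N := (N' + e * n)%N.
pose gen (ij : 'I_N' * 'I_n.+1) := a1 ^+ ij.2 * x ^+ (e * (n - ij.2) + ij.1).
have genE ij : theta (gen ij) = p ^+ (e * n) * (p ^+ ij.1 * t ^+ ij.2).
  rewrite /gen rmorphM !rmorphXn /= -tE exprMn -/p exprD -exprM.
  have -> : (e * n = e * ij.2 + e * (n - ij.2))%N.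
    by rewrite -mulnDr subnKC // -ltnS.
  by rewrite exprD; ring.
pose coef ij (al : 'I_N * 'I_n) := (h (iter al.1 nx (gen ij))).1 al.2.
have [|v [ij0 v0] vM] := linear_dependence coef.
  by rewrite !card_prod !card_ord /N /N'; nia.
pose rest := \sum_ij iota (v ij) * iter N nx (gen ij).
have total : \sum_ij kappa (v ij) * theta (gen ij) = p ^+ N * theta rest.
  have expand ij : theta (gen ij) = \sum_al kappa (coef ij al) * (p ^+ al.1 * theta y ^+ al.2)
      + p ^+ N * theta (iter N nx (gen ij)).
    rewrite (iterated_expansion (val := theta)
      (rem := fun g => \sum_j kappa ((h g).1 j) * theta y ^+ j) _ N hP).
    congr (_ + _); rewrite -(pair_big xpredT xpredT
      (fun a b => kappa (coef ij (a, b)) * (p ^+ a * theta y ^+ b))) /=.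
    by apply: eq_bigr => a _; rewrite mulr_sumr; apply: eq_bigr => b _; rewrite mulrCA.
  under eq_bigr do rewrite expand mulrDr.
  rewrite big_split /= [X in X + _](_ : _ = 0) ?add0r.
    rewrite rmorph_sum mulr_sumr; apply: eq_bigr => ij _.
    by rewrite rmorphM mulrCA.
  under eq_bigr do rewrite mulr_sumr.
  rewrite exchange_big big1 // => al _.
  have := congr1 kappa (vM al); rewrite rmorph0 rmorph_sum /= => vMal.
  transitivity ((\sum_ij theta (iota (v ij * coef ij al))) *
                (p ^+ al.1 * theta y ^+ al.2)); last by rewrite vMal mul0r.
  rewrite mulr_suml.
  by apply: eq_bigr => ij _; rewrite !rmorphM mulrA.
have Dp := theta_m mx.
have pe0 : p ^+ (e * n) != 0 by rewrite expf_neq0.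
have := double_expansion_unique Dp x0 p_inf (v := fun i j => v (i, j)) (thetaD rest).
move=> /(_ _ ij0.1 ij0.2); rewrite -surjective_pairing => v_eq0.
move: v0; rewrite v_eq0 ?eqxx //.
apply: (mulfI pe0); rewrite mulrA -exprD addnC -/N -total.
have -> : \sum_ij kappa (v ij) * theta (gen ij)
        = \sum_i \sum_j kappa (v (i, j)) * theta (gen (i, j)).
  by rewrite pair_big; apply: eq_bigr => -[].
rewrite mulr_sumr; apply: eq_bigr => i _; rewrite !mulr_sumr; apply: eq_bigr => j _.
by rewrite genE /=; ring.
Qed.

Lemma parameter_factor p : D p -> (~ forall s, D (p / t ^+ s)) ->
  exists s u, units D u /\ p = t ^+ s * u.
Proof.
move=> Dp /existsNP[s0 ns0].
have ex : exists s, `[< ~ D (p / t ^+ s) >] by exists s0; apply/asboolP.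
case: (ex_minnP ex) => -[|s] /asboolP ns smin; first by rewrite divr1 in ns.
have Ds : D (p / t ^+ s).
  by apply: contrapT => nd; have /smin : `[< ~ D (p / t ^+ s) >] by [apply/asboolP]; rewrite ltnn.
exists s, (p / t ^+ s); split; last by rewrite mulrC divfK // expf_neq0.
case: (unit_or_nonunit Ds) => // nu; case: ns.
by have := uniformizer_div branch_uniformizer nu; rewrite exprSr invfM mulrA.
Qed.

(** [theta x] is a power of [t] times a unit. Every nonzero element of [R / f] divides a power of
    [theta x], so it too is a power of [t] times a unit, and fractions follow. *)
Lemma branch_spans : uniformizer_spans D t.
Proof.
have [x [y [n [c [mE x0 yn xpow]]]]] := branch_parameter.
have mx : m x by rewrite mE; exact: ideal2_genl.
have [s [u [uu xE]]] := parameter_factor (thetaD x)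
  (branch_parameter_order mE x0 yn xpow).
have xX e : theta x ^+ e = t ^+ (s * e) * u ^+ e by rewrite xE exprMn exprM.
have uX e : units D (u ^+ e) by exact: (units_expz e).
have spanR a : theta a != 0 -> exists (j : int) v, units D v /\ theta a = t ^ j * v.
  move=> /xpow[e [b xe]].
  apply: (uniformizer_divisor (y := theta b) (n := s * e) branch_uniformizer) => //.
  by exists (u ^+ e) => //; rewrite -xX xe mulrC.
move=> l l0; have [a [b [b0 lE]]] := theta_frac l.
have a0 : theta a != 0 by apply: contra_neq l0 => a0; rewrite lE a0 mul0r.
have [i [v [uv aE]]] := spanR _ a0; have [j [w [uw bE]]] := spanR _ b0.
exists (i - j), (v / w); split; first by apply: units_mul => //; exact: units_inv.
have [_ w0 _] := (unitsP D w).1 uw.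
by rewrite lE aE bE expfzDr // -invr_expz invfM; ring.
Qed.

Lemma theta_ideal_pow k a : ideal_pow setT m k a -> D (theta a / t ^+ k).
Proof.
move=> [N [g [gP [c _ ->]]]]; rewrite rmorph_sum mulr_suml.
apply: (sub_sum hD) => j; rewrite rmorphM -mulrA; apply: subM => //.
have [s ms ->] := gP j; rewrite rmorph_prod /=.
have -> : t ^+ k = \prod_(l < k) t by rewrite prodr_const card_ord.
rewrite -prodf_div; apply: (@big_ind _ D) => [||l _]; first exact: sub1.
  by move=> *; exact: subM.
by apply: (uniformizer_div branch_uniformizer); exact: theta_m.
Qed.

Lemma residue_expansion k d : D d ->
  exists (c : 'I_k -> K) d', D d' /\ d = \sum_j kappa (c j) * t ^+ j + t ^+ k * d'.
Proof.
elim: k d => [|k IHk] d Dd; first by exists (fun=> 0), d; rewrite big_ord0 add0r mul1r.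
have [c [d' [Dd' ->]]] := IHk d Dd; have [e] := resD Dd'.
rewrite mD => -[d'' Dd'' d'E].
exists (fun j => oapp c e (insub (val j))), d''; split=> //.
rewrite big_ord_recr /= insubF ?ltnn //=.
have -> : \sum_(i < k) theta (iota (oapp c e (insub (val i)))) * t ^+ i
        = \sum_(i < k) theta (iota (c i)) * t ^+ i.
  by apply: eq_bigr => i _; rewrite valK.
rewrite exprSr -mulrA [t * _]mulrC d'E /=; ring.
Qed.

(* Completeness makes [D] a finite [R]-module, hence integral over [R]. *)
Lemma branch_integral d : D d -> integralOver theta d.
Proof.
have [x [y [n [c [mE x0 yn xpow]]]]] := branch_parameter.
have mx : m x by rewrite mE; exact: ideal2_genl.
have [s [u [uu xE]]] := parameter_factor (thetaD x)
  (branch_parameter_order mE x0 yn xpow).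
have [Du u0 DVu] := (unitsP D u).1 uu.
have s_gt0 : (0 < s)%N.
  case: s xE => [|//]; rewrite mul1r => xE.
  by case: (nonunit_unit uu); rewrite -xE; exact: theta_m.
have /choice[h hP] d0 : exists ce : ('I_s -> K) * L, D d0 ->
    D ce.2 /\ d0 = \sum_j kappa (ce.1 j) * t ^+ j + theta x * ce.2.
  case: (pselect (D d0)) => [Dd0|]; last by exists (fun=> 0, 0).
  have [ce [d' [Dd' d0E]]] := residue_expansion s Dd0.
  exists (ce, d' / u) => _ /=; split; first exact: subM.
  by rewrite {1}d0E xE; congr (_ + _); field.
(* Modulo [theta x], which has order [s], the powers [t ^ l] with [l < s] span [D] over [K].
   Collecting the successive remainders gives, for each [l], a power series in [x], which converges
   in [R]. *)
have combination d0 : D d0 -> exists a : 'I_s -> R, d0 = \sum_l theta (a l) * t ^+ l.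
  move=> Dd0; pose nx e := (h e).2.
  have Dnx N : D (iter N nx d0) by elim: N => // N /hP[].
  have /choice[a aP] l := power_series_limit hR (fun i => iota ((h (iter i nx d0)).1 l)) mx.
  exists a; apply: contrapT => /eqP; rewrite -subr_eq0 => r0.
  have Dr : D (d0 - \sum_l theta (a l) * t ^+ l).
    apply: subB => //; apply: (sub_sum hD) => l; apply: subM => //.
    by apply: subX => //; exact: nonunits_sub Dt.
  have [[j|j] [v [uv rE]]] := branch_spans r0; last first.
    by rewrite rE in Dr; move/(uniformizer_mem branch_uniformizer _ uv): Dr.
  (* A nonzero error would have some order [j]. Truncating all the series after [j.+1] terms shows
     it divisible by [t ^ j.+1]. *)
  suff : D ((d0 - \sum_l theta (a l) * t ^+ l) / t ^+ j.+1).
    have := uniformizer_mem branch_uniformizer (Posz j - Posz j.+1) uv.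
    rewrite rE expfzDr // -exprnN mulrAC => -[h1 _] /h1; lia.
  set N := j.+1.
  have expand : d0 = \sum_(i < N) theta x ^+ i *
      (\sum_l kappa ((h (iter i nx d0)).1 l) * t ^+ l) + theta x ^+ N * iter N nx d0.
    elim: N => [|N IHN]; first by rewrite big_ord0 add0r mul1r.
    have -> : theta x ^+ N.+1 * iter N.+1 nx d0 = theta x ^+ N * iter N nx d0
        - theta x ^+ N * (\sum_l kappa ((h (iter N nx d0)).1 l) * t ^+ l).
      by rewrite {1}(proj2 (hP _ (Dnx N))) exprSr iterS /nx; ring.
    by rewrite big_ord_recr /= {1}IHN; ring.
  have -> : d0 - \sum_l theta (a l) * t ^+ l = theta x ^+ N * iter N nx d0
      - \sum_l theta (a l - \sum_(i < N) iota ((h (iter i nx d0)).1 l) * x ^+ i) * t ^+ l.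
    have -> : \sum_l theta (a l - \sum_(i < N) iota ((h (iter i nx d0)).1 l) * x ^+ i) * t ^+ l
        = \sum_l theta (a l) * t ^+ l - \sum_(i < N) theta x ^+ i *
            (\sum_l kappa ((h (iter i nx d0)).1 l) * t ^+ l).
      rewrite (eq_bigr (fun i : 'I_N => \sum_l
        (theta x ^+ i * kappa ((h (iter i nx d0)).1 l)) * t ^+ l)); last first.
        by move=> i _; rewrite mulr_sumr; apply: eq_bigr => l _; rewrite mulrA.
      rewrite exchange_big -sumrB; apply: eq_bigr => l _.
      rewrite rmorphB mulrBl rmorph_sum -mulr_suml; congr (_ - _ * _).
      by apply: eq_bigr => i _; rewrite rmorphM rmorphXn mulrC.
    by rewrite {1}expand; ring.
  rewrite mulrBl; apply: subB => //.
    rewrite mulrAC -expr_div_n; apply: subM => //; apply: subX => //.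
    exact: (uniformizer_div branch_uniformizer (theta_m mx)).
  rewrite mulr_suml; apply: (sub_sum hD) => l; rewrite mulrAC; apply: subM => //.
    exact: theta_ideal_pow.
  by apply: subX => //; exact: nonunits_sub Dt.
move=> Dd.
have /choice[a aP] (k : 'I_s) := combination (d * t ^+ k)
  (subM hD Dd (subX hD k (nonunits_sub Dt))).
(* Multiplication by [d] on the generators [t ^ l] has the matrix [M] over [R]. The row of these
   generators is an eigenvector for [d], nonzero because it contains [t ^ 0 = 1], so [d] is a root
   of the characteristic polynomial. *)
pose M := \matrix_(l, k) a k l.
exists (char_poly M); first exact: char_poly_monic.
rewrite map_char_poly -eigenvalue_root_char; apply/eigenvalueP.
exists (\row_l t ^+ l).
  apply/rowP => k; rewrite !mxE aP; apply: eq_bigr => l _.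
  by rewrite !mxE mulrC.
apply/eqP => /rowP/(_ (Ordinal s_gt0)); rewrite !mxE expr0 => /eqP.
by rewrite oner_eq0.
Qed.

End Normalization.
End Branch.

(** * The strict transform of a branch *)

Lemma frac_repr (R : idomainType) (g : {fraction R}) :
  exists a b, b != 0 /\ g = tofrac a / tofrac b.
Proof.
elim/quotW: g => g; exists (\n_g), (\d_g).
have d0 : \d_g != 0 by exact: denom_ratioP.
split=> //; have td0 : (@tofrac R) \d_g != 0 by rewrite tofrac_eq0.
apply: (mulIf td0); rewrite divfK //.
rewrite [LHS](_ : _ = FracField.mul (\pi_({fraction R}) g)%qT ((@tofrac R) \d_g)) //.
rewrite !piE; apply/eqmodP; rewrite /= FracField.equivfE /FracField.mulf.
rewrite !numden_Ratio ?(mulf_neq0, oner_eq0, denom_ratioP) //.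
by apply/eqP; ring.
Qed.

Section StrictTransform.
Variables (K : closedFieldType) (R : idomainType) (iota : {rmorphism K -> R}).
Hypotheses (hR : complete_regular_local2 R) (hK : coefficient_field iota).
(* [F] stands for the fraction field of [R] and [B] for the local ring of the
   branch; they are kept abstract to prevent unfolding of fractions. *)
Variables (F : fieldType) (toF : {rmorphism R -> F}) (base B : set F).
Hypothesis toF_eq0 : forall a, (toF a == 0) = (a == 0).
Hypothesis toF_frac : forall g, exists a b, b != 0 /\ g = toF a / toF b.
Hypothesis base_toF : forall a, base (toF a).
Hypothesis base_dom : forall a, nonunits setT a -> nonunits base (toF a).
Local Notation m := (@nonunits R setT).
Variables (f : R) (L : fieldType) (theta : {rmorphism R -> L}).
Hypothesis f_irr : irreducible_elt f.
Hypothesis theta_ker : forall g, theta g = 0 <-> multiples f g.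
Hypothesis theta_frac : forall l, exists a b, theta b != 0 /\ l = theta a / theta b.
Implicit Types (T W : set F) (g u v x y : F).
Local Notation kappa := (toF \o iota).
Local Notation regular_point := (regular_point kappa base).
Hypothesis branch_ringP : forall g,
  B g <-> exists a b, theta b != 0 /\ g = toF a / toF b.

Lemma theta_neq0 b : theta b != 0 -> toF b != 0.
Proof.
move=> tb; rewrite toF_eq0; apply: contra_neq tb => ->; exact: rmorph0.
Qed.

(* The residue map of the local ring of the branch. *)
Definition psi g : L :=
  xget 0 [set l | exists a b,
    [/\ theta b != 0, g = toF a / toF b & l = theta a / theta b]].

Lemma psi_frac a b : theta b != 0 -> psi (toF a / toF b) = theta a / theta b.
Proof.
move=> tb; apply: xget_unique; first by exists a, b.
move=> _ [a' [b' [tb' e ->]]]; apply/eqP; rewrite eqr_div // -!rmorphM.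
have := e; move/eqP; rewrite eqr_div ?theta_neq0 // -!rmorphM -subr_eq0 -rmorphB toF_eq0 subr_eq0.
by move=> /eqP ->.
Qed.

Lemma psi_toF a : psi (toF a) = theta a.
Proof.
have t1 : theta 1 != 0 by rewrite rmorph1 oner_eq0.
by rewrite -[toF a]divr1 -[1](rmorph1 toF) psi_frac // rmorph1 divr1.
Qed.

Lemma psi1 : psi 1 = 1. Proof. by rewrite -(rmorph1 toF) psi_toF rmorph1. Qed.
Lemma psi0 : psi 0 = 0. Proof. by rewrite -(rmorph0 toF) psi_toF rmorph0. Qed.

Lemma psiD g h : B g -> B h -> psi (g + h) = psi g + psi h.
Proof.
move=> /branch_ringP[a [b [tb ->]]] /branch_ringP[c [d [td ->]]].
have [b0 d0] := (theta_neq0 tb, theta_neq0 td).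
have tbd : theta (b * d) != 0 by rewrite rmorphM mulf_neq0.
rewrite addf_div // -!rmorphM -rmorphD !psi_frac //.
by rewrite rmorphD !rmorphM addf_div.
Qed.

Lemma psiM g h : B g -> B h -> psi (g * h) = psi g * psi h.
Proof.
move=> /branch_ringP[a [b [tb ->]]] /branch_ringP[c [d [td ->]]].
have tbd : theta (b * d) != 0 by rewrite rmorphM mulf_neq0.
rewrite mulf_div -!rmorphM !psi_frac //.
by rewrite !rmorphM mulf_div.
Qed.

Lemma branch_toF a : B (toF a).
Proof.
apply/branch_ringP; exists a, 1; rewrite !rmorph1 oner_eq0 divr1; split=> //.
Qed.

Lemma branch_ring_subring : is_subring B.
Proof.
split; first by rewrite -(rmorph1 toF); exact: branch_toF.
- move=> _ _ /branch_ringP[a [b [tb ->]]] /branch_ringP[c [d [td ->]]].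
  apply/branch_ringP; exists (a * d - c * b), (b * d).
  rewrite rmorphM mulf_neq0 // rmorphB !rmorphM; split=> //.
  by have [b0 d0] := (theta_neq0 tb, theta_neq0 td); field; rewrite b0 d0.
- move=> _ _ /branch_ringP[a [b [tb ->]]] /branch_ringP[c [d [td ->]]].
  apply/branch_ringP; exists (a * c), (b * d).
  by rewrite rmorphM mulf_neq0 // !rmorphM mulf_div.
Qed.
Local Notation hB := branch_ring_subring.

Lemma psiN g : B g -> psi (- g) = - psi g.
Proof.
move=> Bg; apply/eqP; rewrite -addr_eq0 -psiD //; last exact: (subN hB).
by rewrite addNr psi0.
Qed.

Lemma psiB g h : B g -> B h -> psi (g - h) = psi g - psi h.
Proof. by move=> Bg Bh; rewrite psiD ?psiN //; exact: (subN hB). Qed.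

Lemma psiX g n : B g -> psi (g ^+ n) = psi g ^+ n.
Proof.
move=> Bg; elim: n => [|n IHn]; first exact: psi1.
by rewrite !exprS psiM ?IHn //; exact: (subX hB).
Qed.

Lemma psi_nonunit g : B g -> psi g = 0 <-> nonunits B g.
Proof.
move=> Bg; split=> [g0|[_ nu]].
  split=> // -[_ [h Bh /(congr1 psi)]]; rewrite psiM // g0 mul0r psi1 => /eqP.
  by rewrite eq_sym oner_eq0.
apply/eqP/negPn/negP => g0; apply: nu; split=> //.
have /branch_ringP[a [b [tb gE]]] := Bg.
have ta : theta a != 0.
  by apply: contra_neq g0 => ta; rewrite gE psi_frac // ta mul0r.
exists (toF b / toF a); first by apply/branch_ringP; exists b, a.
by rewrite gE mulrA divfK ?divff ?theta_neq0.
Qed.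

Lemma multiples_exp_cancel n c s : theta s != 0 ->
  (exists a, c * s = a * f ^+ n) -> exists a, c = a * f ^+ n.
Proof.
move=> ts; have f0 : f != 0 by case: f_irr.
have ff : theta f = 0 by apply/theta_ker; exists 1; rewrite ?mul1r.
elim: n c => [|n IHn] c [a cs]; first by exists c; rewrite mulr1.
have /theta_ker[d _ dE] : theta c = 0.
  apply: (mulIf ts); rewrite mul0r -rmorphM cs rmorphM rmorphXn ff expr0n /=.
  by rewrite mulr0.
have [|e dE'] := IHn d.
  by exists a; apply: (mulIf f0); rewrite -[RHS]mulrA -exprSr -cs -dE; ring.
by exists e; rewrite -dE dE' exprSr mulrA.
Qed.

(** The numerator of [y] is a multiple of [f]. Since [f] is prime, divisibility of [g] by [y ^ n]
    puts its numerator into the ideal of [f ^ n], hence into every power of the maximal ideal of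
    [R]. *)
Lemma branch_ring_separated g y : B g -> B y -> y != 0 -> psi y = 0 ->
  (forall n, B (g / y ^+ n)) -> g = 0.
Proof.
move=> /branch_ringP[c [d [td ->]]] /branch_ringP[a [b [tb ->]]].
have [b0 d0] := (theta_neq0 tb, theta_neq0 td).
rewrite psi_frac // => y0 /eqP; rewrite mulf_eq0 invr_eq0 (negPf tb) orbF => /eqP.
move=> /theta_ker[a' _ aE] Bn.
have a0 : toF a != 0 by apply: contra_neq y0 => ->; rewrite mul0r.
suff -> : c = 0 by rewrite rmorph0 mul0r.
case: (hR) => _ _ _ _ [sep _]; apply: sep => n.
have fm : m f by apply/nonunitsTP; case: f_irr.
suff [e ->] : exists e, c = e * f ^+ n by exact: ideal_pow_mulX.
have /branch_ringP[p [q [tq e]]] := Bn n.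
have q0 := theta_neq0 tq.
apply: (multiples_exp_cancel (s := b ^+ n * q)).
  by rewrite rmorphM rmorphXn mulf_neq0 // expf_neq0.
exists (p * d * a' ^+ n); apply/eqP; rewrite -subr_eq0 -toF_eq0 rmorphB subr_eq0.
apply/eqP.
have -> : p * d * a' ^+ n * f ^+ n = p * d * a ^+ n by rewrite -aE exprMn mulrA.
rewrite !rmorphM !rmorphXn /=.
have : toF c * toF b ^+ n / (toF d * toF a ^+ n) = toF p / toF q.
  by rewrite -e expr_div_n; field; rewrite !expf_neq0 // b0 d0 a0.
move=> /eqP; rewrite eqr_div ?mulf_neq0 ?expf_neq0 // => /eqP h.
by rewrite mulrA h; ring.
Qed.

Lemma psi_unit T g : T `<=` B -> units T g -> psi g != 0.
Proof.
move=> TB [/TB Bg [h /TB Bh /(congr1 psi)]]; rewrite psiM // psi1 => gh.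
by apply: contra_eq_neq gh => ->; rewrite mul0r eq_sym oner_neq0.
Qed.

(** The last two clauses make [y] an equation of the strict transform at [T]: it generates the
    kernel of [psi] on [T]. *)
Definition curve_point T x y : Prop :=
  [/\ regular_point T, T `<=` B, regular_pair T x y, psi y = 0
    & forall g, T g -> psi g = 0 -> T (g / y)].

Lemma nonsingular_curve_point T : regular_point T -> T `<=` B ->
  nonsingular_at T (divisor_ideal T B) -> exists x y, curve_point T x y.
Proof.
move=> rT TB [y [x [mE IE]]]; have [lT _ _ [u [v uv]]] := rT.
have hT := proj1 lT.
have mE' : nonunits T = ideal2 T x y.
  rewrite mE; apply/seteqP; split=> _ [a Ta [b Tb <-]];
    by exists b => //; exists a => //; rewrite addrC.
have syz := regular_pair_change lT uv mE'; have [_ x0 y0 _] := syz.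
exists x, y; split=> // [|g Tg g0].
  have : ideal1 T y y by exists 1; [exact: sub1 | rewrite mul1r].
  by rewrite -IE => -[Ty ny]; apply/psi_nonunit => //; exact: TB.
have : divisor_ideal T B g by split=> //; apply/psi_nonunit => //; exact: TB.
by rewrite IE => -[a Ta <-]; rewrite mulfK.
Qed.

Section CurvePoint.
Variables (T : set F) (x y : F).
Hypothesis cT : curve_point T x y.
Local Notation D := (psi @` T).

Let rT : regular_point T. Proof. by case: cT. Qed.
Let TB : T `<=` B. Proof. by case: cT. Qed.
Let lT : local_subring T. Proof. by case: rT. Qed.
Let hT : is_subring T. Proof. by case: lT. Qed.
Let mE : nonunits T = ideal2 T x y. Proof. by case: cT => _ _ []. Qed.
Let nx : nonunits T x. Proof. by rewrite mE; have [] := ideal2_gen x y hT. Qed.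
Let ny : nonunits T y. Proof. by rewrite mE; have [] := ideal2_gen x y hT. Qed.
Let x0 : x != 0. Proof. by case: cT => _ _ []. Qed.
Let y0 : y != 0. Proof. by case: cT => _ _ []. Qed.
Let psiy : psi y = 0. Proof. by case: cT. Qed.
Let Ttheta a : T (toF a). Proof. by case: rT => _ [sub _] _ _; apply: sub; exact: base_toF. Qed.

Lemma curve_point_subring : is_subring D.
Proof.
split.
- by exists 1; [exact: sub1 | exact: psi1].
- move=> _ _ [g Tg <-] [h Th <-]; exists (g - h); first exact: subB.
  by rewrite psiB //; exact: TB.
- move=> _ _ [g Tg <-] [h Th <-]; exists (g * h); first exact: subM.
  by rewrite psiM //; exact: TB.
Qed.

Lemma curve_point_units g : units T g -> units D (psi g).
Proof.
move=> [Tg [h Th gh]]; split; first by exists g.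
by exists (psi h); [exists h | rewrite -psiM ?gh ?psi1 //; exact: TB].
Qed.

(** An inverse of [psi g] lifts to some [h] in [T] with [g h - 1] a multiple of [y], hence a
    nonunit; then 1 would be a nonunit as well. *)
Lemma curve_point_nonunits g : nonunits T g -> nonunits D (psi g).
Proof.
move=> ng; have Tg := nonunits_sub ng; split; first by exists g.
move=> [_ [_ [h Th <-] gh]]; have Tgh : T (g * h - 1).
  by apply: subB => //; [exact: subM | exact: sub1].
have [_ _ _ _ /(_ _ Tgh) div] := cT.
have /div Tq : psi (g * h - 1) = 0.
  rewrite psiB ?psiM ?gh ?psi1 ?subrr //; try exact: TB.
    by apply: TB; exact: subM.
  by apply: TB; exact: sub1.
apply: (nonunits1 hT).
have -> : 1 = h * g - (g * h - 1) / y * y by rewrite divfK //; ring.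
by apply: nonunits_subr => //; apply: nonunits_mul.
Qed.

Lemma curve_point_local : local_subring D.
Proof.
split=> [|_ _ [[g Tg <-] ng] [[h Th <-] nh]]; first exact: curve_point_subring.
have n g' : T g' -> ~ units D (psi g') -> nonunits T g'.
  move=> Tg' nu; case: (unit_or_nonunit Tg') => // /curve_point_units.
  by move/nu.
rewrite -psiD; [|exact: TB|exact: TB].
by apply: curve_point_nonunits; apply: nonunits_add => //; exact: n.
Qed.

Lemma curve_point_unit_lift d : units D d -> exists2 v, units T v & psi v = d.
Proof.
move=> ud; have [[v Tv vE] _] := ud; exists v => //.
case: (unit_or_nonunit Tv) => // /curve_point_nonunits.
by rewrite vE => /(nonunit_unit ud).
Qed.

Lemma curve_point_maximal : nonunits D = ideal1 D (psi x).
Proof.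
apply/seteqP; split=> [d nd|_ [_ [a Ta <-] <-]]; last first.
  by apply: nonunits_mul; [exact: curve_point_subring | exists a |
                          exact: curve_point_nonunits].
have [[g Tg gE] nu] := nd.
have : nonunits T g.
  case: (unit_or_nonunit Tg) => // /curve_point_units.
  by rewrite gE => /nu.
rewrite mE => -[a Ta [b Tb e]]; exists (psi a); first by exists a.
have [Tx Ty] := (nonunits_sub nx, nonunits_sub ny).
rewrite -gE -e psiD ?psiM ?psiy ?mulr0 ?addr0 //; try (apply: TB => //);
  exact: subM.
Qed.

Lemma curve_point_theta a : D (theta a).
Proof. by exists (toF a); [exact: Ttheta | exact: psi_toF]. Qed.

Lemma curve_point_dominates a : m a -> nonunits D (theta a).
Proof.
move=> ma; rewrite -psi_toF; apply: curve_point_nonunits.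
by case: rT => _ [_ dom] _ _; apply: dom; exact: base_dom.
Qed.

Lemma curve_point_residue d : D d ->
  exists c, nonunits D (d - (theta \o iota) c).
Proof.
move=> [g Tg <-]; have [_ _ /(_ g Tg)[c nc] _] := rT; exists c.
rewrite /= -psi_toF -psiB; [|exact: TB|exact: branch_toF].
exact: curve_point_nonunits.
Qed.

Lemma curve_point_uniformizer : uniformizer D (psi x).
Proof.
exact: (branch_uniformizer hR f_irr theta_ker curve_point_local
  curve_point_dominates curve_point_maximal).
Qed.

Lemma curve_point_spans : uniformizer_spans D (psi x).
Proof.
exact: (branch_spans hR f_irr theta_ker theta_frac curve_point_local
  curve_point_theta curve_point_dominates curve_point_maximal hK).
Qed.

(** One inclusion holds because a discrete valuation ring is integrally closed, the other is
    integrality of [D] over [R]. *)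
Lemma curve_point_normalization (O : comNzRingType) (rho : {rmorphism R -> O})
    (phi : {rmorphism O -> L}) : (forall o, exists a, rho a = o) ->
  (forall a, phi (rho a) = theta a) -> normalization phi = D.
Proof.
move=> surj phiE; apply/seteqP; split=> d.
  move=> [p p1 root_p].
  apply: (uniformizer_integrally_closed curve_point_uniformizer
    curve_point_spans (p := map_poly phi p)) => // [|i].
    exact: monic_map.
  have [a aE] := surj p`_i.
  by rewrite coef_map /= -aE phiE; exact: curve_point_theta.
move=> Dd; have [p p1 root_p] := branch_integral hR f_irr theta_ker theta_frac
  curve_point_local curve_point_theta curve_point_dominates curve_point_residue
  curve_point_maximal hK Dd.
exists (map_poly rho p); first exact: monic_map.
rewrite -map_poly_comp; move: root_p; congr (root _ _).
by apply: eq_map_poly => a /=; rewrite phiE.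
Qed.

End CurvePoint.

(* In [T / x] every nonzero element is a power of [y] times a unit. *)
Definition fibre_dvr T x y : Prop :=
  forall g, T g -> T (g / x) \/ exists j u, units T u /\ T ((g - y ^+ j * u) / x).

(** The given chart has an arbitrary equation [z = a x + b y]. Lying on the branch forces [a] to be
    a unit and [y / z] to vanish at the point, after which [z] and [x] differ by a unit of [T']. *)
Lemma curve_point_step T T' x y : curve_point T x y ->
  exceptional_point T T' -> T' `<=` B ->
  [/\ curve_point T' x (y / x), fibre_dvr T' x (y / x) & dominated T T'].
Proof.
move=> cT TT' T'B; have [rT TB [mE x0 y0 syz] psiy div] := cT.
have bc c : base (kappa c) by exact: base_toF.
have rT' := regular_exceptional_point bc rT TT'.
have [lT _ _ [u0 [v0 uv0]]] := rT; have hT := proj1 lT.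
have [lT' _ _ [u0' [v0' uv0']]] := rT'; have hT' := proj1 lT'.
have dTT' := near_dominated (exceptional_point_near TT').
have [sTT' nTT'] := dTT'.
have [z [[nz z0] chT' [w0 mzw0] frac coord]] := exceptional_pointP bc rT TT'.
have [nx ny] : nonunits T x /\ nonunits T y by rewrite mE; exact: ideal2_gen.
have [Tx Ty] := (nonunits_sub nx, nonunits_sub ny).
have Tz := nonunits_sub nz.
have T'd g : nonunits T g -> T' (g / z) by move=> ng; apply: chT'; exact: chart_div.
have psix0 : psi x != 0 by case: (curve_point_uniformizer cT).
have := nz; rewrite mE => -[a Ta [b Tb zE]].
have [T'a T'b] := (sTT' _ Ta, sTT' _ Tb).
have psiz : psi z = psi a * psi x.
  by rewrite -zE psiD ?psiM ?psiy ?mulr0 ?addr0 //; apply: TB => //; exact: subM.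
(* Otherwise [1 - a (x / z)] would be a unit of [T'] killed by [psi], since
   [psi z = psi a * psi x]. *)
have ua : units T a.
  case: (unit_or_nonunit Ta) => // na; exfalso.
  have n1 : units T' (1 - a * (x / z)).
    apply: units_sub => //; first exact: units_one.
    by rewrite mulrC; apply: nonunits_mul => //; [exact: T'd | exact: nTT'].
  have T'1 := sub1 hT'; have T'xz := T'd _ nx.
  have /eqP := psi_unit T'B n1; apply.
  rewrite psiB ?psi1; [|exact: T'B|by apply: T'B; exact: subM].
  rewrite psiM; [|exact: T'B|exact: T'B].
  apply: (mulIf psix0); rewrite mul0r mulrBl mul1r mulrAC -psiz -psiM; try exact: T'B.
    by rewrite mulrC divfK // subrr.
  exact: T'B (sTT' _ Tz).
have [_ a0 TVa] := (unitsP T a).1 ua.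
have mzy : nonunits T = ideal2 T z y.
  apply/seteqP; split=> g.
    rewrite mE => -[c Tc [d Td <-]]; exists (c / a); first exact: subM.
    exists (d - c / a * b); last by rewrite -zE; field.
    by apply: subB => //; apply: subM => //; exact: subM.
  by move=> [c Tc [d Td <-]]; apply: nonunits_add => //; exact: nonunits_mul.
have psiz0 : psi z != 0.
  by rewrite psiz mulf_neq0 //; exact: psi_unit TB ua.
have T't := T'd _ ny.
have psit : psi (y / z) = 0.
  apply: (mulIf psiz0); rewrite mul0r -psiM ?divfK //; try exact: T'B.
  exact: T'B (sTT' _ Tz).
have nt : nonunits T' (y / z).
  by split=> // /(psi_unit T'B); rewrite psit eqxx.
have [c [mE' _ tc0 _]] := coord y mzy.
(* [y / z] is a nonunit because [psi] kills it, and so is [y / z - kappa c]. *)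
have c0 : c = 0.
  apply/eqP/negPn/negP => c0; case: (nonunit_unit (regular_point_units bc rT' c0)).
  have nk : nonunits T' (y / z - (y / z - kappa c)).
    by apply: nonunits_subr => //; rewrite mE'; exact: (proj2 (ideal2_gen _ _ hT')).
  have kE : y / z - (y / z - kappa c) = kappa c by ring.
  by rewrite kE in nk; exact: nk.
rewrite c0 rmorph0 subr0 in mE' tc0.
have [e [ue zex]] : exists e, units T' e /\ z = e * x.
  (* The relation [z = a x + b y] reads [z (1 - b (y / z)) = a x]. *)
  have uden : units T' (1 - b * (y / z)).
    by apply: units_sub => //; [exact: units_one | exact: nonunits_mul].
  exists (a / (1 - b * (y / z))); split.
    by apply: units_mul => //; [exact: units_incl sTT' ua | exact: units_inv].
  have [_ den0 _] := (unitsP _ _).1 uden.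
  rewrite mulrAC; apply: (mulIf den0); rewrite divfK // mulrBr mulr1.
  by rewrite -{1}zE; field.
have [T'e e0 T'Ve] := (unitsP _ _).1 ue.
have yxE : y / x = e * (y / z) by rewrite zex; field; rewrite x0 e0.
have T'yx : T' (y / x) by rewrite yxE; exact: subM.
have mE'' : nonunits T' = ideal2 T' x (y / x).
  have gz g : g * z = g * e * x by rewrite {1}zex mulrA.
  rewrite mE'; apply/seteqP; split=> _ [g T'g [h T'h <-]].
    exists (g * e); first exact: subM.
    exists (h / e); first exact: subM.
    by rewrite gz yxE; field; rewrite z0 e0.
  exists (g / e); first exact: subM.
  exists (h * e); first exact: subM.
  by rewrite gz yxE; field; rewrite z0 e0.
have frac' g : T' g -> exists (P : {poly F}) v, [/\ forall i, T P`_i, units T' v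
    & g = P.[y / z] * v].
  move=> /frac[g1 [g2 [cg1 cg2 ug2 ->]]].
  have [P TP ->] := chartP lT mzy z0 cg1.
  by exists P, g2^-1; split=> //; exact: units_inv.
have T'P (P : {poly F}) : (forall i, T P`_i) -> T' P.[y / z].
  by move=> TP; apply: chT'; exact: (horner_chart lT mzy).
have T'z := sTT' _ Tz.
split=> //.
- split=> //; first exact: regular_pair_change lT' uv0' mE''.
    rewrite yxE psiM ?psit ?mulr0 //; exact: T'B.
  move=> g /frac'[P [v [TP uv gE]]] psig; have [T'v vn0 T'Vv] := (unitsP _ _).1 uv.
  have psiP : psi P.[y / z] = 0.
    have -> : P.[y / z] = g / v by rewrite gE mulfK.
    rewrite psiM ?psig ?mul0r //; apply: T'B => //.
    by rewrite gE; apply: subM => //; exact: T'P.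
  rewrite gE; have -> : P.[y / z] * v / (y / x) = P.[y / z] / (y / z) * (v / e).
    by rewrite yxE; field; rewrite ?e0 ?y0 ?z0.
  apply: subM => //; last exact: subM.
  (* Only the constant coefficient [d] survives under [psi]; being killed by [psi], it is a multiple
     of [y = (y / z) z]. *)
  elim/poly_ind: P TP psiP {gE} => [|P d _] TP.
    by rewrite horner0 mul0r => _; exact: sub0.
  have /coef_consP[TP' Td] := TP.
  have T'P' := T'P _ TP'; have T'd' := sTT' _ Td.
  rewrite hornerMXaddC => psiPd.
  have pd : psi d = 0.
    move: psiPd; rewrite psiD; [|by apply: T'B; exact: subM|exact: T'B].
    by rewrite psiM; [rewrite psit mulr0 add0r|exact: T'B|exact: T'B].
  have Tdy := div _ Td pd; rewrite mulrDl mulfK ?mulf_neq0 ?invr_eq0 //.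
  apply: subD => //.
  have -> : d / (y / z) = d / y * z by field; rewrite y0 z0.
  by apply: subM => //; exact: sTT'.
- move=> g /frac'[P [v [TP uv ->]]]; have [T'v vn0 T'Vv] := (unitsP _ _).1 uv.
  have xz h : T' (h / z) -> T' (h / x).
    by move=> T'h; have -> : h / x = h / z * e; [rewrite zex; field; rewrite x0 e0 | exact: subM].
  suff [T'Pz|[j [u [uu T'u]]]] : T' (P.[y / z] / z) \/
      exists j u, units T' u /\ T' ((P.[y / z] - (y / z) ^+ j * u) / z).
  + by left; apply: xz; rewrite mulrAC; exact: subM.
  + right; exists j, (u * v / e ^+ j); split.
      apply: units_mul => //; first exact: units_mul.
      by apply: units_inv; exact: (units_expz j).
    apply: xz.
    have -> : (P.[y / z] * v - (y / x) ^+ j * (u * v / e ^+ j)) / z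
      = (P.[y / z] - (y / z) ^+ j * u) / z * v.
      rewrite yxE exprMn; field; rewrite ?z0 ?expf_neq0 //.
    exact: subM.
  (* The exponent [j] is the index of the first coefficient of [P] that is a unit of [T]; if there
     is none, the value is a multiple of [z]. *)
  elim/poly_ind: P TP => [_|P d IHP].
    by left; rewrite horner0 mul0r; exact: sub0.
  move=> /coef_consP[TP Td]; rewrite hornerMXaddC; have T'P' := T'P _ TP.
  case: (unit_or_nonunit Td) => [ud|nd].
    right; exists 0%N, (P.[y / z] * (y / z) + d); split.
      rewrite addrC; apply: units_add => //; first exact: units_incl sTT' ud.
      exact: nonunits_mul.
    by rewrite expr0 mul1r subrr mul0r; exact: sub0.
  have T'dz := T'd _ nd.
  case: (IHP TP) => [T'Pz|[j [u [uu T'u]]]]; [left|right].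
    have -> : (P.[y / z] * (y / z) + d) / z = P.[y / z] / z * (y / z) + d / z by ring.
    by apply: subD => //; exact: subM.
  exists j.+1, u; split=> //.
  have -> : (P.[y / z] * (y / z) + d - (y / z) ^+ j.+1 * u) / z
    = (P.[y / z] - (y / z) ^+ j * u) / z * (y / z) + d / z.
    by rewrite exprS; field.
  by apply: subD => //; exact: subM.
Qed.

Lemma curve_point_lift T x y g h : curve_point T x y -> T g -> T h ->
  psi g = psi h -> exists2 b, T b & g = h + y * b.
Proof.
move=> [[[hT _] _ _ _] TB [_ _ y0 _] _ div] Tg Th gh.
exists ((g - h) / y); last by rewrite mulrC divfK //; ring.
by apply: div; [exact: subB | rewrite psiB ?gh ?subrr //; exact: TB].
Qed.

(** If all powers of [x] divide [g], those of [psi x] divide [psi g], which is then 0, so [y]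
    divides [g]. By the syzygies the powers of [x] still divide [g / y]. Repeating this, all powers
    of [y] divide [g], which is impossible in the local ring of the branch. *)
Lemma curve_point_separated T x y g : curve_point T x y -> T g -> g != 0 ->
  ~ forall n, T (g / x ^+ n).
Proof.
move=> cT Tg g0 gx; have [[[hT _] _ _ _] TB [_ x0 y0 syz] psiy div] := cT.
have Ty : T y.
  case: cT => _ _ [mE _ _ _] _ _; apply: nonunits_sub; rewrite mE.
  exact: (proj2 (ideal2_gen x y hT)).
have Tx : T x.
  case: cT => _ _ [mE _ _ _] _ _; apply: nonunits_sub; rewrite mE.
  exact: (proj1 (ideal2_gen x y hT)).
have syzX n a b : T a -> T b -> a * x ^+ n = b * y -> T (b / x ^+ n).
  elim: n b => [|n IHn] b Ta Tb ab; first by rewrite divr1.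
  have Tbx : T (b / x).
    apply: (syz (a * x ^+ n)) => //; first by apply: subM => //; exact: subX.
    by rewrite -ab exprSr mulrA.
  rewrite exprS invfM mulrA; apply: IHn => //.
  by apply: (mulIf x0); rewrite -[LHS]mulrA -exprSr ab [RHS]mulrAC divfK.
have divy h : T h -> (forall n, T (h / x ^+ n)) -> T (h / y).
  move=> Th hx; apply: div => //; apply: contrapT => /eqP psih.
  have [j [u [uu psihE]]] := curve_point_spans cT psih.
  have tP := curve_point_uniformizer cT.
  have [[_ _ t0] lD] := (tP, curve_point_local cT).
  have Dq (l : nat) : (psi @` T) (psi h * psi x ^ (- l%:Z)).
    exists (h / x ^+ l) => //; have /TB Bq := hx l.
    have := psiM Bq (TB _ (subX hT l Tx)); rewrite divfK ?expf_neq0 // => ->.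
    rewrite psiX; last exact: TB.
    by rewrite -exprnN mulfK // expf_neq0.
  have := Dq `|j|.+1%N; rewrite psihE mulrAC -expfzDr //.
  by move/(uniformizer_mem tP _ uu); lia.
have all n : T (g / y ^+ n) /\ forall l, T (g / y ^+ n / x ^+ l).
  elim: n => [|n [Tn Tnx]]; first by rewrite divr1.
  have Tn1 : T (g / y ^+ n.+1) by rewrite exprSr invfM mulrA; exact: divy.
  split=> // l; apply: (syzX l (g / y ^+ n / x ^+ l)) => //.
  by rewrite divfK ?expf_neq0 // exprSr invfM mulrA divfK.
move/eqP: g0; apply; apply: (branch_ring_separated (y := y)) => //; try exact: TB.
by move=> n; apply: TB; case: (all n).
Qed.

(** * Components through a point of the branch *)

Section Component.
Variables (T0 T W : set F) (x y : F) (k : nat).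
Local Notation yk := (y / x ^+ k).
Local Notation D := (psi @` T0).
Hypotheses (cT0 : curve_point T0 x y) (cT : curve_point T x yk).
Hypotheses (fT : fibre_dvr T x yk) (dT0 : dominated T0 T).
Hypotheses (lW : local_subring W) (bW : dominated base W).
Hypotheses (TW : T `<=` W) (nTW : ~ dominated T W).
Hypothesis large : exists (h : R) (j : int) (u : L),
  [/\ nonunits setT h, units D u, theta h = psi x ^ j * u & j < k%:Z].

Let hW : is_subring W := proj1 lW.
Let hT : is_subring T. Proof. by case: cT => -[[]]. Qed.
Let lT : local_subring T. Proof. by case: cT => -[]. Qed.
Let hT0 : is_subring T0. Proof. by case: cT0 => -[[]]. Qed.
Let mE : nonunits T = ideal2 T x yk. Proof. by case: cT => _ _ []. Qed.
Let nx : nonunits T x. Proof. by rewrite mE; have [] := ideal2_gen x yk hT. Qed.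
Let ny : nonunits T yk. Proof. by rewrite mE; have [] := ideal2_gen x yk hT. Qed.
Let x0 : x != 0. Proof. by case: cT => _ _ []. Qed.
Let yE : y = x ^+ k * yk. Proof. by rewrite mulrC divfK // expf_neq0. Qed.
Let T0T : T0 `<=` T := proj1 dT0.
Let uT0 : uniformizer D (psi x). Proof. exact: curve_point_uniformizer cT0. Qed.
Let T0toF a : T0 (toF a).
Proof. by case: cT0 => -[_ [sub _] _ _] _ _ _ _; exact: sub. Qed.
Let T0x : T0 x.
Proof.
case: cT0 => _ _ [mE0 _ _ _] _ _; apply: nonunits_sub; rewrite mE0.
exact: (proj1 (ideal2_gen x y hT0)).
Qed.
Let T0B : T0 `<=` B. Proof. by case: cT0. Qed.

(* Up to order [k], the value along [x] of an element of [R] is the order of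
   its restriction to the branch. *)
Lemma component_factor a (j : nat) (u : L) : (j < k)%N -> units D u ->
  theta a = psi x ^+ j * u -> exists2 v, units T v & toF a = x ^+ j * v.
Proof.
move=> jk /(curve_point_unit_lift cT0)[v uv vE] aE.
have Tv : T0 v by case: uv.
have [|||b Tb e] := curve_point_lift cT0 (g := toF a) (h := x ^+ j * v) => //.
- by apply: subM => //; exact: subX.
- by rewrite psi_toF aE psiM ?psiX ?vE //; apply: T0B => //; exact: subX.
exists (v + x * (x ^+ (k - j.+1) * b * yk)); last first.
  rewrite e {1}yE; set Y := yk.
  have -> : x ^+ k = x ^+ j * x * x ^+ (k - j.+1) by rewrite -exprSr -exprD subnKC.
  by ring.
apply: units_add => //; first exact: units_incl hT0 hT T0T uv.
rewrite mulrC; apply: nonunits_mul => //; apply: subM => //; last exact: nonunits_sub ny.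
by apply: subM => //; [apply: subX => //; exact: nonunits_sub nx | exact: T0T].
Qed.

Let Wx : nonunits W x.
Proof.
have [h [j [u [mh uu hE jk]]]] := large.
case: (unit_or_nonunit (TW (nonunits_sub nx))) => // ux.
have Dh : D (psi x ^ j * u) by rewrite -hE; exact: (curve_point_theta cT0).
case: j hE jk Dh => j hE jk Dh; last by move/(uniformizer_mem uT0 _ uu): Dh.
have [v uv e] := component_factor jk uu hE.
have : nonunits W (toF h) by case: bW => _; apply; exact: base_dom.
rewrite e => /nonunit_unit; case; apply: units_mul => //.
  by apply: (units_expz j).
exact: units_incl hT hW TW uv.
Qed.

Let Wy : units W yk.
Proof.
case: (unit_or_nonunit (TW (nonunits_sub ny))) => // nyW; case: nTW; split=> // g.
rewrite mE => -[a Ta [b Tb <-]].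
by apply: nonunits_add => //; apply: nonunits_mul => //; exact: TW.
Qed.

(** Modulo [x], which vanishes on the component, such an element is a power of [yk] times a unit of
    [T], and [yk] is a unit of [W]. *)
Lemma component_unit g : T g -> ~ T (g / x) -> units W g.
Proof.
move=> Tg ng; case: (fT Tg) => // -[j [u [uu Tq]]].
rewrite -(subrK (yk ^+ j * u) g) addrC; apply: units_add => //.
  apply: units_mul => //; first exact: (units_expz j hW Wy).
  exact: units_incl hT hW TW uu.
by rewrite -(divfK x0 (g - _)); apply: nonunits_mul => //; exact: TW.
Qed.

Lemma component_spans : uniformizer_spans W x.
Proof.
have spanT g : T g -> g != 0 -> exists (n : nat) u, units W u /\ g = x ^+ n * u.
  move=> Tg g0; have /existsNP[n0 nn0] := curve_point_separated cT Tg g0.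
  have ex : exists n, `[< ~ T (g / x ^+ n) >] by exists n0; apply/asboolP.
  case: (ex_minnP ex) => -[|n] /asboolP nn nmin; first by rewrite divr1 in nn.
  have Tn : T (g / x ^+ n).
    by apply: contrapT => nd; have /nmin : `[< ~ T (g / x ^+ n) >] by [apply/asboolP]; rewrite ltnn.
  exists n, (g / x ^+ n); split; last by rewrite mulrC divfK // expf_neq0.
  by apply: component_unit => //; move: nn; rewrite exprSr invfM mulrA.
move=> g g0; have [a [b [b0 gE]]] := toF_frac g.
have a0 : toF a != 0 by apply: contra_neq g0 => a0; rewrite gE a0 mul0r.
have tb0 : toF b != 0 by rewrite toF_eq0.
have [i [u [uu aE]]] := spanT _ (T0T (T0toF a)) a0.
have [j [v [uv bE]]] := spanT _ (T0T (T0toF b)) tb0.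
exists (i%:Z - j%:Z), (u / v); split; first by apply: units_mul => //; exact: units_inv.
have [_ v0 _] := (unitsP W v).1 uv.
by rewrite gE aE bE expfzDr // -exprnN -exprnP invfM; ring.
Qed.

Lemma component_uniformizer : uniformizer W x.
Proof.
split=> //; apply/seteqP; split=> [g ng|_ [a Wa <-]]; last exact: nonunits_mul.
have [->|g0] := eqVneq g 0; first by exists 0; [exact: sub0 | rewrite mul0r].
have [[[|n]|n] [u [uu gE]]] := component_spans g0.
- by case: (nonunit_unit uu); move: ng; rewrite gE mul1r.
- exists (x ^+ n * u); last by rewrite gE mulrAC -exprSr.
  by apply: subM => //; [apply: subX => //; exact: nonunits_sub Wx | case: uu].
- case: (nonunit_unit uu); have -> : u = x ^+ n.+1 * g.
    by rewrite gE NegzE -exprnN mulVKf // expf_neq0.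
  by apply: nonunits_mul => //; apply: subX => //; exact: nonunits_sub Wx.
Qed.

(** The value [j = k] is included: order at least [k] on the branch forces value at least [k] on the
    component, even where the exact values differ. *)
Lemma component_compare a (j : int) : j <= k%:Z ->
  W (toF a * x ^ (- j)) <-> D (theta a * psi x ^ (- j)).
Proof.
have hD := curve_point_subring cT0; have t0 : psi x != 0 by case: uT0.
have Da : D (theta a) by exact: (curve_point_theta cT0).
have Wa : W (toF a) by apply: TW; apply: T0T.
case: j => j jk; last first.
  rewrite NegzE opprK -exprnP; split=> _.
    by apply: (subM hD Da); apply: (subX hD); exists x.
  by apply: (subM hW Wa); apply: (subX hW); exact: nonunits_sub Wx.
rewrite -!exprnN; split=> [Wq|[h T0h hE]].
  have [ta0|ta0] := eqVneq (theta a) 0; first by rewrite ta0 mul0r; exact: sub0.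
  have [i [u [uu aE]]] := curve_point_spans cT0 ta0.
  move: (Da); rewrite aE => /(uniformizer_mem uT0 _ uu).
  case: i aE => // i aE _; rewrite exprnN mulrAC -expfzDr //.
  apply/(uniformizer_mem uT0 _ uu); rewrite subr_ge0 lez_nat leqNgt.
  apply/negP => ij; have [|v uv e] := component_factor _ uu aE; first exact: leq_trans jk.
  move: Wq; rewrite e exprnN exprnP mulrAC -expfzDr //.
  move/(uniformizer_mem component_uniformizer _ (units_incl hT hW TW uv)).
  by rewrite subr_ge0 lez_nat leqNgt ij.
have [|||b Tb e] := curve_point_lift cT0 (g := toF a) (h := x ^+ j * h) => //.
- by apply: subM => //; exact: subX.
- rewrite psi_toF psiM ?psiX ?hE //; try (apply: T0B => //; exact: subX).
  by rewrite mulrC divfK // expf_neq0.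
have -> : toF a / x ^+ j = h + x ^+ (k - j) * yk * b.
  rewrite e {1}yE; set Y := yk.
  have -> : x ^+ k = x ^+ j * x ^+ (k - j) by rewrite -exprD subnKC.
  by field; rewrite expf_neq0.
apply: TW; apply: subD => //; first exact: T0T.
apply: subM => //; last exact: T0T.
apply: subM => //; last exact: nonunits_sub ny.
by apply: subX => //; exact: nonunits_sub nx.
Qed.

End Component.

End StrictTransform.

(** * Comparison of values along one branch *)

Section ApproachingBranch.
Variables (K : closedFieldType) (R : idomainType) (iota : {rmorphism K -> R}).
Hypotheses (hR : complete_regular_local2 R) (hK : coefficient_field iota).
Local Notation F := {fraction R}.
Local Notation toF := (@tofrac R : {rmorphism R -> F}).
Variables (X : model F) (r : nat) (f : 'I_r -> R).
Hypothesis X_mod : modification X.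
Variables (O : comNzRingType) (rho : {rmorphism R -> O}).
Hypothesis rho_curve : curve_ring f rho.
Variables (i : 'I_r) (L : fieldType) (phi : {rmorphism O -> L}).
Hypothesis phi_field : branch_field rho (f i) phi.
Hypothesis f_irr : irreducible_elt (f i).
Hypothesis f_smooth : forall T, closed_points X T -> T `<=` branch_ring (f i) ->
  nonsingular_at T (divisor_ideal T (branch_ring (f i))).

Definition branch_map : {rmorphism R -> L} := phi \o rho.
Local Notation theta := branch_map.
Local Notation B := (branch_ring (f i)).
Local Notation Xk := (iterated_blowup f X).

Lemma rho_surj o : exists a, rho a = o.
Proof. by case: rho_curve => /(_ o). Qed.

Lemma branch_map_ker g : theta g = 0 <-> multiples (f i) g.
Proof.
have [_ ker] := rho_curve; have [kerphi _] := phi_field.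
split=> [/kerphi[o _]|[a _ <-]].
  have [a <-] := rho_surj o; rewrite -rmorphM => /eqP; rewrite eq_sym -subr_eq0.
  rewrite -rmorphB => /eqP/ker[c _ cE].
  exists (a + c * \prod_(j | j != i) f j) => //.
  apply/eqP; rewrite mulrDl addrC eq_sym -subr_eq -cE (bigD1 i) //=.
  by apply/eqP; ring.
by apply/kerphi; exists (rho a) => //; rewrite -rmorphM.
Qed.

Lemma branch_map_frac l : exists a b, theta b != 0 /\ l = theta a / theta b.
Proof.
have [_ /(_ l)[o [o' [o'0 ->]]]] := phi_field.
have [a aE] := rho_surj o; have [b bE] := rho_surj o'.
by exists a, b; rewrite /= aE bE; split=> //; apply/eqP.
Qed.

Lemma branch_ring_frac g :
  B g <-> exists a b, theta b != 0 /\ g = toF a / toF b.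
Proof.
split=> [[_ [a _ <-] [_ [[b _ <-] nb] <-]]|[a [b [tb ->]]]].
  exists a, b; split=> //; apply/eqP => /branch_map_ker tb; apply: nb.
  by exists b.
exists (toF a); first by exists a.
exists (toF b) => //; split; first by exists b.
move=> [c /branch_map_ker tc /eqP]; rewrite tofrac_eq => /eqP cb.
by rewrite -cb tc eqxx in tb.
Qed.

Lemma base_ring_dominates a : nonunits setT a -> nonunits (@base_ring R) (toF a).
Proof. by move/base_ring_nonunit. Qed.

Lemma base_ring_toF a : base_ring (toF a).
Proof. by exists a. Qed.

Local Notation psi := (psi toF theta).
Local Notation curve_point := (curve_point iota toF (@base_ring R) B theta).

Let toF_eq0 := @tofrac_eq0 R.
Let toF_frac := @frac_repr R.

(* The point of the [k]-th blow-up on the branch lies over a point of [X],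
   at which only the coordinate [y] of the branch changes, to [y / x ^ k]. *)
Lemma curve_point_descent k T : closed_points (Xk k) T -> T `<=` B ->
  exists T0 x y, [/\ curve_point T0 x y, curve_point T x (y / x ^+ k),
    dominated T0 T & (0 < k)%N -> fibre_dvr T x (y / x ^+ k)].
Proof.
have sep k' := iterated_blowup_separated hR hK f k' X_mod.
elim: k T => [|k IHk] T.
  move=> XT TB; have [reg _ _ _] := sep 0%N.
  have [x [y cT]] := nonsingular_curve_point toF_eq0 branch_ring_frac
    (reg _ XT) TB (f_smooth XT TB).
  by exists T, x, y; rewrite expr0 divr1; split=> //; split.
(* A point of the previous model that lies on the branch has been blown up, so only new points
   remain. *)
move=> [[XT nT] TB|[T1 [XT1 _] T1T] TB].
  by case: nT; split=> //; exists i.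
have [T1i _] := near_dominated (exceptional_point_near T1T).
have T1B : T1 `<=` B by move=> g /T1i/TB.
have [T0 [x [y [cT0 cT1 d01 _]]]] := IHk _ XT1 T1B.
have [cT fT d1] := curve_point_step hR toF_eq0 base_ring_toF
  base_ring_dominates f_irr branch_map_ker branch_ring_frac cT1 T1T TB.
have yE : y / x ^+ k / x = y / x ^+ k.+1 by rewrite exprSr invfM mulrA.
rewrite yE in cT fT; exists T0, x, y; split=> //.
exact: dominated_trans d1.
Qed.

Section Point.
Variables (T : set F) (x y : F).
Hypothesis cT : curve_point T x y.

Lemma branch_normalization : normalization phi = psi @` T.
Proof.
exact: (curve_point_normalization hR hK toF_eq0 base_ring_toF base_ring_dominates
  f_irr branch_map_ker branch_map_frac branch_ring_frac cT rho_surj).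
Qed.

Lemma branch_order_ge (j : int) a :
  (j%:E <= branch_order phi (rho a))%E <-> (psi @` T) (theta a * psi x ^ (- j)).
Proof.
rewrite /branch_order branch_normalization; apply: ordv_ge.
  exact: (curve_point_uniformizer hR toF_eq0 base_ring_dominates
    f_irr branch_map_ker branch_ring_frac cT).
exact: (curve_point_spans hR hK toF_eq0 base_ring_toF base_ring_dominates
  f_irr branch_map_ker branch_map_frac branch_ring_frac cT).
Qed.

End Point.

Lemma approaching_compare : exists k0, forall k W, (k0 <= k)%N ->
  exc_components (Xk k) W -> meets_branch (Xk k) W (f i) ->
  forall (j : int) a, j <= k%:Z ->
    (j%:E <= ordv W (toF a))%E <-> (j%:E <= branch_order phi (rho a))%E.
Proof.
have [p [p1 [n0 [c0 [mE p0 _ _]]]]] := branch_parameter hR f_irr branch_map_ker.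
have mp : nonunits setT p by rewrite mE; exact: ideal2_genl.
(* [p] is an element of the maximal ideal that does not vanish on the branch; beyond its order the
   hypothesis [large] on components holds. *)
exists `|fine (branch_order phi (rho p))|.+1%N => k W k_large XW [T [XT TW TB]] j a jk.
have [T0 [x [y [cT0 cT dT0 /(_ _)fT]]]] := curve_point_descent XT TB.
have {}fT := fT (leq_ltn_trans (leq0n _) k_large).
have [_ comp _ sepW] := iterated_blowup_separated hR hK f k X_mod.
have [lW bW] := comp _ XW; have nTW := sepW _ _ XT XW.
have uni := curve_point_uniformizer hR toF_eq0 base_ring_dominates
    f_irr branch_map_ker branch_ring_frac cT0.
have large : exists (h : R) (j : int) (u : L),
    [/\ nonunits setT h, units (psi @` T0) u, theta h = psi x ^ j * u & j < k%:Z].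
  have [j' [u [uu pE]]] := curve_point_spans hR hK toF_eq0 base_ring_toF
    base_ring_dominates f_irr branch_map_ker branch_map_frac branch_ring_frac cT0 p0.
  exists p, j', u; split=> //.
  have := k_large; rewrite /branch_order (branch_normalization cT0).
  rewrite (ordvE uni uu pE) /=; lia.
rewrite (branch_order_ge cT0).
have spans := component_spans hR hK toF_eq0 toF_frac base_ring_toF
  base_ring_dominates f_irr branch_map_ker branch_map_frac branch_ring_frac
  cT0 cT fT dT0 lW bW TW nTW large.
have uniW := component_uniformizer hR hK toF_eq0 toF_frac base_ring_toF
  base_ring_dominates f_irr branch_map_ker branch_map_frac branch_ring_frac
  cT0 cT fT dT0 lW bW TW nTW large.
rewrite (ordv_ge uniW (toF a) j spans).
exact: (component_compare hR hK toF_eq0 toF_frac base_ring_toF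
  base_ring_dominates f_irr branch_map_ker branch_map_frac branch_ring_frac
  cT0 cT fT dT0 lW bW TW nTW large).
Qed.

Lemma branch_order_ge0 o : (exists T, closed_points X T /\ T `<=` B) ->
  (0 <= branch_order phi o)%E.
Proof.
move=> [T [XT TB]]; have [T0 [x [y [cT0 _ _ _]]]] := @curve_point_descent 0 T XT TB.
have [a <-] := rho_surj o; apply/(branch_order_ge cT0).
rewrite oppr0 expr0z mulr1.
exact: (curve_point_theta toF_eq0 base_ring_toF cT0).
Qed.

End ApproachingBranch.

(** * From values to Poincare series *)

Lemma flat_laurent_series (K : fieldType) (A : nzRingType) (j : K -> A) r
    (v : 'I_r -> A -> \bar int) i :
  (forall g, (0 <= v i g)%E) -> flat_below i (laurent_series j v).
Proof.
move=> v_ge0 m mi_lt0; rewrite /laurent_series.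
(* As [v i] is nonnegative, a bound at [i] that is at most 0 imposes nothing; for [m 0 i < 0] this
   covers both [m] and [m + const_mx 1]. *)
have idealE (n n' : 'rV[int]_r) : (forall l, l != i -> n 0 l = n' 0 l) ->
    n 0 i <= 0 -> n' 0 i <= 0 -> valuation_ideal v n `<=` valuation_ideal v n'.
  move=> nn' ni n'i g vg l; have [->|li] := eqVneq l i; last by rewrite -nn'.
  by apply: le_trans (v_ge0 g); rewrite lee_fin.
have same (n n' : 'rV[int]_r) : (forall l, l != i -> n 0 l = n' 0 l) ->
    n 0 i <= 0 -> n' 0 i <= 0 -> valuation_ideal v n = valuation_ideal v n'.
  move=> nn' ni n'i; apply/seteqP; split; apply: idealE => // l li.
  by rewrite nn'.
congr (_%:Z); congr quot_dim; apply: same => [l li||];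
  rewrite ?mxE ?eqxx ?(negPf li) /=; lia.
Qed.

Theorem corollary2
    (K : closedFieldType) (R : idomainType) (iota : {rmorphism K -> R})
    (hR : complete_regular_local2 R) (hK : coefficient_field iota)
    (r : nat) (hr : (1 < r)%N)
    (nu : 'I_r -> {fraction R} -> \bar int)
    (hnu : forall i, divisorial_valuation iota (nu i))
    (hnu_distinct : forall i j, nu i =1 nu j -> i = j)
    (X : model {fraction R}) (hX : minimal_resolution nu X)
    (f : 'I_r -> R) (hf : general_curve nu X f)
    (nus : nat -> 'I_r -> {fraction R} -> \bar int)
    (hnus : approaching_valuations X f nus)
    (O : comNzRingType) (rho : {rmorphism R -> O}) (hO : curve_ring f rho)
    (L : 'I_r -> fieldType) (phi : forall i, {rmorphism O -> L i})
    (hphi : forall i, branch_field rho (f i) (phi i)) :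
  coefficientwise_limit
    (fun k => divisorial_poincare_series iota (nus k))
    (curve_poincare_series iota rho phi).
Proof.
have [[X_mod _] _] := hX; have [curv _] := hf.
have irr i : irreducible_elt (f i) by have [W _ []] := curv i.
have smooth i T : closed_points X T -> T `<=` branch_ring (f i) ->
    nonsingular_at T (divisor_ideal T (branch_ring (f i))).
  by have [W _ [_ sm _]] := curv i; exact: sm.
have pt i : exists T, closed_points X T /\ T `<=` branch_ring (f i).
  by have [W _ [_ _ [T [XT TB _ _ _]]]] := curv i; exists T.
have ord_ge0 i o : (0 <= branch_order (phi i) o)%E.
  exact: (branch_order_ge0 hR hK X_mod hO (hphi i) (irr i) (@smooth i) o (pt i)).
have /choice[k0 k0P] i :=
  approaching_compare hR hK X_mod hO (hphi i) (irr i) (@smooth i).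
(* The sum of the thresholds serves all branches at once. *)
have cmp k i (j : int) a : (\sum_i k0 i <= k)%N -> j <= k%:Z ->
    (j%:E <= nus k i (tofrac a))%E <-> (j%:E <= branch_order (phi i) (rho a))%E.
  move=> k_large jk; have [W [XW nusE] meet] := hnus k i.
  rewrite nusE; apply: (k0P i k W) => //.
  by apply: (leq_trans _ k_large); rewrite (bigD1 i) //= leq_addr.
have [rho_surj _] := hO.
apply: (poincare_limit (ltnW hr) (k0 := (\sum_i k0 i)%N)) => [k i k_large|i|k m k_large mk].
- by apply: flat_laurent_series => a; apply/(cmp k i 0).
- exact: flat_laurent_series.
have idealE (n : 'rV[int]_r) : (forall i, n 0 i <= k%:Z) ->
    valuation_ideal (fun i g => nus k i (tofrac g)) n
    = rho @^-1` valuation_ideal (fun i => branch_order (phi i)) n.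
  move=> nk; apply/seteqP.
  by split=> a va i; apply/(cmp k i (n 0 i) a k_large (nk i)); exact: va.
(* The strict bound on [m] is what also brings the exponent [m + const_mx 1] of the smaller ideal
   under [k]. *)
rewrite /laurent_series !idealE ?quot_dim_preimage // => i.
  by rewrite !mxE lezD1; exact: mk.
exact: ltW.
Qed.
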